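(* Let $\mathcal{A}$ be a $(\Gamma,\lambda)$-commutative algebra, let $r_{\bar0},r_{\bar1}\in\mathbb{N}$ and $\boldsymbol{\nu}=(\boldsymbol{\nu}_{\bar0},\boldsymbol{\nu}_{\bar1})\in\Gamma_{\bar0}^{\,r_{\bar0}}\times\Gamma_{\bar1}^{\,r_{\bar1}}$. For $\varsigma\in\mathfrak{S}(\lambda)$ put $\Gamma\mathrm{Ber}_\varsigma:=\mathrm{Ber}\circ J_\varsigma$. 1. The maps $\Gamma\mathrm{Ber}_\varsigma:\mathsf{GL}^0(\boldsymbol{\nu};\mathcal{A})\to\mathcal{A}^\times$ do not depend on the choice of $\varsigma\in\mathfrak{S}(\lambda)$ and define a group morphism. 2. For every $x\in\Gamma_{\bar0}$, the maps $\Gamma\mathrm{Ber}_\varsigma$ are well-defined on matrices $X\in\mathsf{GL}^x(\boldsymbol{\nu};\mathcal{A})$ and are given by $$\Gamma\mathrm{Ber}_\varsigma(X)=\varsigma(x,x)^{-r_{\bar1}(r_{\bar0}-r_{\bar1})}\;\Gamma\!\det{}_\varsigma\big(\mathcal{X}_{00}-\mathcal{X}_{01}\mathcal{X}_{11}^{-1}\mathcal{X}_{10}\big)\cdot\Gamma\!\det{}_\varsigma(\mathcal{X}_{11})^{-1},$$ where $X=\begin{pmatrix}\mathcal{X}_{00}&\mathcal{X}_{01}\\\mathcal{X}_{10}&\mathcal{X}_{11}\end{pmatrix}$ is the block decomposition of $X$ according to parity, and the products and inverses on the right-hand side are taken in $\mathcal{A}$.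
   Context: $\mathbb{K}$ is a field of characteristic zero and $\Gamma$ is a finitely generated abelian group. $\lambda:\Gamma\times\Gamma\to\mathbb{K}^\times$ is a commutation factor: biadditive with $\lambda(x,y)\lambda(y,x)=1$. A $(\Gamma,\lambda)$-commutative algebra is an associative unital $\Gamma$-graded $\mathbb{K}$-algebra $\mathcal{A}=\bigoplus_\gamma\mathcal{A}^\gamma$ with $ab=\lambda(\tilde a,\tilde b)ba$ for homogeneous $a,b$ ($\tilde a$ is the degree). $\mathcal{A}^\times$ is the group of invertible elements. Parity: $\Gamma_{\bar0}=\{x:\lambda(x,x)=1\}$, $\Gamma_{\bar1}=\{x:\lambda(x,x)=-1\}$, and $\bar x\in\mathbb{Z}_2$ is the parity of $x$. $\mathfrak{S}(\lambda)$ is the set of NS-multipliers: biadditive maps $\varsigma:\Gamma\times\Gamma\to\mathbb{K}^\times$ with $\lambda(x,y)\varsigma(x,y)\varsigma(y,x)^{-1}=(-1)^{\bar x\bar y}$. For $\varsigma\in\mathfrak{S}(\lambda)$, $\underline{\mathcal{A}}$ is the graded vector space $\mathcal{A}$ with product $a\star b=\varsigma(\tilde a,\tilde b)ab$; it is supercommutative for the parity. For $\boldsymbol{\nu}\in\Gamma^n$, an $n\times n$ matrix $X=(X^i_{\ j})$ over $\mathcal{A}$ is homogeneous of degree $x$ if $X^i_{\ j}\in\mathcal{A}^{x-\nu_i+\nu_j}$ for all $i,j$; $\mathsf{GL}^x(\boldsymbol{\nu};\mathcal{A})$ is the set of invertible matrices homogeneous of degree $x$. $J_\varsigma(X)$ is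 the matrix over $\underline{\mathcal{A}}$ with entries $\varsigma(x,\nu_j)\,\varsigma(\nu_i,x-\nu_i+\nu_j)^{-1}X^i_{\ j}$, for $X$ homogeneous of degree $x$. Here $n=r_{\bar0}+r_{\bar1}$; for $x\in\Gamma_{\bar0}$, the diagonal blocks have even entries and the off-diagonal blocks have odd entries, so $J_\varsigma(X)$ is an even supermatrix. $\mathrm{Ber}$ is the usual Berezinian of invertible even supermatrices over $\underline{\mathcal{A}}$: $\mathrm{Ber}\begin{pmatrix}\mathcal{Y}_{00}&\mathcal{Y}_{01}\\\mathcal{Y}_{10}&\mathcal{Y}_{11}\end{pmatrix}=\det(\mathcal{Y}_{00}-\mathcal{Y}_{01}\mathcal{Y}_{11}^{-1}\mathcal{Y}_{10})\star\det(\mathcal{Y}_{11})^{-1}$, everything computed in $\underline{\mathcal{A}}$; its values are regarded as elements of the vector space $\mathcal{A}=\underline{\mathcal{A}}$. For a square homogeneous matrix $Y$ of even degree with respect to $\boldsymbol{\nu}_{\bar0}$ (resp. $\boldsymbol{\nu}_{\bar1}$), $\Gamma\!\det_\varsigma(Y):=\det(J_\varsigma(Y))$, where $J_\varsigma$ is defined by the same formula with $\boldsymbol{\nu}$ replaced by $\boldsymbol{\nu}_{\bar0}$ (resp. $\boldsymbol{\nu}_{\bar1}$) and $\det$ is the determinant over the commutative even part of $\underline{\mathcal{A}}$. The matrix $\mathcal{X}_{00}-\mathcal{X}_{01}\mathcal{X}_{11}^{-1}\mathcal{X}_{10}$ is homogeneous of degree $x$ with respect to $\boldsymbol{\nu}_{\bar0}$,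 and $\mathcal{X}_{11}$ is homogeneous of degree $x$ with respect to $\boldsymbol{\nu}_{\bar1}$. *)

(* Defs.v *)
From HB Require Import structures.
From mathcomp Require Import all_boot all_order all_algebra.
From mathcomp Require Import boolp classical_sets.

Set Implicit Arguments.
Unset Strict Implicit.
Unset Printing Implicit Defensive.

Import Order.TTheory GRing.Theory Num.Theory.
Local Open Scope ring_scope.

Definition finitely_generated (G : zmodType) : Prop :=
  exists (n : nat) (g : 'I_n -> G),
    forall x, exists c : 'I_n -> int, x = \sum_i g i *~ c i.

(* Biadditive maps G x G -> K^*. *)
Record bicharacter (K : fieldType) (G : zmodType) := Bicharacter {
  bichar_fun :> G -> G -> K;
  bichar_neq0 : forall x y, bichar_fun x y != 0;
  bicharDl : forall x y z,
    bichar_fun (x + y) z = bichar_fun x z * bichar_fun y z;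
  bicharDr : forall x y z,
    bichar_fun x (y + z) = bichar_fun x y * bichar_fun x z }.

Definition commutation_factor (K : fieldType) (G : zmodType)
    (lam : bicharacter K G) : Prop :=
  forall x y, lam x y * lam y x = 1.

Section Parity.
Variables (K : fieldType) (G : zmodType) (lam : bicharacter K G).

Definition even_deg (x : G) : bool := lam x x == 1.

(* The parity of x is the value of this boolean, true standing for 1 in Z/2. *)
Definition odd_deg (x : G) : bool := lam x x == -1.

Definition NS_multiplier (s : bicharacter K G) : Prop :=
  forall x y, lam x y * s x y * (s y x)^-1 = (-1) ^+ (odd_deg x && odd_deg y).

End Parity.

Section BicharacterTheory.
Variables (K : fieldType) (G : zmodType) (s : bicharacter K G).

Lemma bichar0l x : s 0 x = 1.
Proof.
by apply: (mulfI (bichar_neq0 s 0 x)); rewrite mulr1 -bicharDl addr0.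
Qed.

Lemma bichar0r x : s x 0 = 1.
Proof.
by apply: (mulfI (bichar_neq0 s x 0)); rewrite mulr1 -bicharDr addr0.
Qed.

End BicharacterTheory.

(* The decomposition A = \bigoplus_g A^g: the homogeneous parts are subspaces *)
(* that span A (gr_span) and are independent (gr_indep).                      *)
Record grading (K : fieldType) (G : zmodType) (A : algType K) := Grading {
  gr_part :> G -> A -> Prop;
  gr0 : forall g, gr_part g 0;
  grP : forall g (c : K) a b,
    gr_part g a -> gr_part g b -> gr_part g (c *: a + b);
  gr_span : forall a, exists (r : seq G) (f : G -> A),
    (forall g, gr_part g (f g)) /\ a = \sum_(g <- r) f g;
  gr_indep : forall (r : seq G) (f : G -> A), uniq r ->
    (forall g, gr_part g (f g)) -> \sum_(g <- r) f g = 0 ->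
    forall g, g \in r -> f g = 0;
  gr1 : gr_part 0 1;
  grM : forall g h a b,
    gr_part g a -> gr_part h b -> gr_part (g + h) (a * b) }.

Definition graded_commutative (K : fieldType) (G : zmodType) (A : algType K)
    (lam : bicharacter K G) (gA : grading G A) : Prop :=
  forall g h a b, gA g a -> gA h b -> a * b = lam g h *: (b * a).

Section Components.
Variables (K : fieldType) (G : zmodType) (A : algType K) (gA : grading G A).
Implicit Types (a b c : A) (g h : G) (r : seq G).

Definition decomposes a (d : seq G * (G -> A)) : Prop :=
  [/\ uniq d.1, forall g, gA g (d.2 g),
      forall g, g \notin d.1 -> d.2 g = 0 & a = \sum_(g <- d.1) d.2 g].

Lemma grD g a b : gA g a -> gA g b -> gA g (a + b).
Proof. by move=> ha hb; rewrite -[a]scale1r; apply: grP. Qed.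

Lemma grZ g k a : gA g a -> gA g (k *: a).
Proof. by move=> ha; rewrite -[_ *: _]addr0; apply: grP => //; apply: gr0. Qed.

Lemma grB g a b : gA g a -> gA g b -> gA g (a - b).
Proof. by move=> ha hb; rewrite addrC -scaleN1r; apply: grP. Qed.

Lemma gr_sum g (I : Type) (r : seq I) (f : I -> A) :
  (forall i, gA g (f i)) -> gA g (\sum_(i <- r) f i).
Proof. by move=> hf; elim/big_ind: _ => //; [apply: gr0 | apply: grD]. Qed.

Lemma decomposes_exists a : exists d, decomposes a d.
Proof.
have [r [f [hf ->]]] := gr_span gA a.
exists (undup r, fun g => f g *+ count_mem g r); split=> /=.
- exact: undup_uniq.
- by move=> g; rewrite -scaler_nat; apply: grZ.
- by move=> g; rewrite mem_undup => /count_memPn ->; rewrite mulr0n.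
- by rewrite -big_undup_iterop_count; apply: eq_bigr => g _.
Qed.

Definition hdecomp a : seq G * (G -> A) := sval (cid (decomposes_exists a)).

(* A finite set of degrees containing those of the nonzero components. *)
Definition hsupp a : seq G := (hdecomp a).1.
Definition hcomp a g : A := (hdecomp a).2 g.

Lemma hdecompP a : decomposes a (hdecomp a).
Proof. by rewrite /hdecomp; case: cid. Qed.

Lemma hsupp_uniq a : uniq (hsupp a).
Proof. by case: (hdecompP a). Qed.

Lemma hcomp_gr a g : gA g (hcomp a g).
Proof. by case: (hdecompP a). Qed.

Lemma hcomp_notin a g : g \notin hsupp a -> hcomp a g = 0.
Proof. by case: (hdecompP a) => _ _ + _; apply. Qed.

Lemma hcomp_sum a : a = \sum_(g <- hsupp a) hcomp a g.
Proof. by case: (hdecompP a). Qed.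

Lemma big_hsupp (V : nmodType) a r (F : G -> V) :
  uniq r -> {subset hsupp a <= r} -> (forall g, g \notin hsupp a -> F g = 0) ->
  \sum_(g <- hsupp a) F g = \sum_(g <- r) F g.
Proof.
move=> ur sr F0; rewrite [RHS](bigID (mem (hsupp a))) /=.
rewrite [X in _ + X]big1 ?addr0; last by move=> g; apply: F0.
rewrite -[RHS]big_filter; apply: perm_big; apply: uniq_perm.
- exact: hsupp_uniq.
- exact: filter_uniq.
- move=> g; rewrite mem_filter /=.
  by case: (boolP (g \in hsupp a)) => //= /sr ->.
Qed.

Lemma hcomp_uniq a r (f : G -> A) : uniq r -> (forall g, gA g (f g)) ->
  (forall g, g \notin r -> f g = 0) -> a = \sum_(g <- r) f g ->
  forall g, hcomp a g = f g.
Proof.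
move=> ur hf f0 ea g; apply/eqP; rewrite -subr_eq0; apply/eqP.
pose t := undup (hsupp a ++ r).
have ut : uniq t by apply: undup_uniq.
have [gt|gt] := boolP (g \in t); last first.
  move: gt; rewrite mem_undup mem_cat negb_or => /andP[g1 g2].
  by rewrite hcomp_notin // f0 // subr0.
apply: (@gr_indep _ _ _ gA t (fun g => hcomp a g - f g)) => //.
  by move=> h; apply: grB => //; apply: hcomp_gr.
rewrite big_split sumrN /=.
have e1 : \sum_(h <- t) hcomp a h = a.
  rewrite [RHS]hcomp_sum; apply/esym/big_hsupp => //; last exact: hcomp_notin.
  by move=> h hh; rewrite mem_undup mem_cat hh.
have e2 : \sum_(h <- t) f h = a.
  rewrite [RHS]ea [LHS](bigID (mem r)) /=.
  rewrite [X in _ + X]big1 ?addr0; last by move=> h; apply: f0.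
  rewrite -[LHS]big_filter; apply: perm_big; apply: uniq_perm => //.
    exact: filter_uniq.
  by move=> h; rewrite mem_filter mem_undup mem_cat /= orbC andb_idr // => ->.
by rewrite e1 e2 subrr.
Qed.

Lemma hcomp_lin k a b g : hcomp (k *: a + b) g = k *: hcomp a g + hcomp b g.
Proof.
pose t := undup (hsupp a ++ hsupp b).
have sa : {subset hsupp a <= t}.
  by move=> h hh; rewrite mem_undup mem_cat hh.
have sb : {subset hsupp b <= t}.
  by move=> h hh; rewrite mem_undup mem_cat hh orbT.
apply: (hcomp_uniq (r := t) (f := fun g => k *: hcomp a g + hcomp b g)).
- exact: undup_uniq.
- by move=> h; apply: grP; apply: hcomp_gr.
- move=> h; rewrite mem_undup mem_cat negb_or => /andP[h1 h2].
  by rewrite !hcomp_notin // scaler0 addr0.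
rewrite big_split -scaler_sumr /=; congr (_ *: _ + _).
- rewrite [LHS]hcomp_sum; apply: big_hsupp => //; last exact: hcomp_notin.
  exact: undup_uniq.
- rewrite [LHS]hcomp_sum; apply: big_hsupp => //; last exact: hcomp_notin.
  exact: undup_uniq.
Qed.

Lemma hcomp_homog g a h : gA g a -> hcomp a h = if h == g then a else 0.
Proof.
move=> ha; move: h.
apply: (hcomp_uniq (r := [:: g]) (f := fun h => if h == g then a else 0)) => //.
- by move=> h; case: eqP => [->//|_]; apply: gr0.
- by move=> h; rewrite inE => /negbTE ->.
- by rewrite big_seq1 eqxx.
Qed.

Lemma hcomp_ind (P : A -> Prop) : P 0 -> (forall a b, P a -> P b -> P (a + b)) ->
  (forall g a, gA g a -> P a) -> forall a, P a.
Proof.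
move=> P0 PD Ph a; rewrite [a]hcomp_sum; elim/big_ind: _ => // g _.
by apply: (Ph g); apply: hcomp_gr.
Qed.

End Components.

(* The algebra A with the product a * b = s(|a|, |b|) ab on homogeneous       *)
(* elements (lemma twistedM), extended bilinearly.                            *)
Definition twisted (K : fieldType) (G : zmodType) (A : algType K)
  (gA : grading G A) (s : bicharacter K G) : Type := A.

Definition untwist (K : fieldType) (G : zmodType) (A : algType K)
  (gA : grading G A) (s : bicharacter K G) (a : twisted gA s) : A := a.

Section Star.
Variables (K : fieldType) (G : zmodType) (A : algType K) (gA : grading G A).
Variable s : bicharacter K G.
Implicit Types (a b c : A) (g h : G).

Definition star a b : A :=
  \sum_(g <- hsupp gA a) \sum_(h <- hsupp gA b)
    s g h *: (hcomp gA a g * hcomp gA b h).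

Lemma starW (r t : seq G) a b : uniq r -> uniq t ->
  {subset hsupp gA a <= r} -> {subset hsupp gA b <= t} ->
  star a b = \sum_(g <- r) \sum_(h <- t)
    s g h *: (hcomp gA a g * hcomp gA b h).
Proof.
move=> ur ut sr st; rewrite /star (big_hsupp ur sr).
  apply: eq_bigr => g _; apply: big_hsupp => // h hh.
  by rewrite (hcomp_notin hh) mulr0 scaler0.
by move=> g hg; apply: big1 => h _; rewrite (hcomp_notin hg) mul0r scaler0.
Qed.

Lemma star_linl k a b c : star (k *: a + b) c = k *: star a c + star b c.
Proof.
pose r := undup (hsupp gA (k *: a + b) ++ hsupp gA a ++ hsupp gA b).
have ur : uniq r by apply: undup_uniq.
have uc := hsupp_uniq gA c.
rewrite !(@starW r (hsupp gA c)) //; first last.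
- by move=> x hx; rewrite mem_undup !mem_cat hx.
- by move=> x hx; rewrite mem_undup !mem_cat hx !orbT.
- by move=> x hx; rewrite mem_undup !mem_cat hx !orbT.
rewrite scaler_sumr -big_split; apply: eq_bigr => g _ /=.
rewrite scaler_sumr -big_split; apply: eq_bigr => h _ /=.
by rewrite hcomp_lin mulrDl scalerDr -scalerAl !scalerA mulrC.
Qed.

Lemma star_linr k a b c : star c (k *: a + b) = k *: star c a + star c b.
Proof.
pose r := undup (hsupp gA (k *: a + b) ++ hsupp gA a ++ hsupp gA b).
have ur : uniq r by apply: undup_uniq.
have uc := hsupp_uniq gA c.
rewrite !(@starW (hsupp gA c) r) //; first last.
- by move=> x hx; rewrite mem_undup !mem_cat hx.
- by move=> x hx; rewrite mem_undup !mem_cat hx !orbT.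
- by move=> x hx; rewrite mem_undup !mem_cat hx !orbT.
rewrite scaler_sumr -big_split; apply: eq_bigr => g _ /=.
rewrite scaler_sumr -big_split; apply: eq_bigr => h _ /=.
by rewrite hcomp_lin mulrDr scalerDr -scalerAr !scalerA mulrC.
Qed.

Lemma starDl : left_distributive star +%R.
Proof. by move=> a b c; rewrite -[a]scale1r star_linl !scale1r. Qed.

Lemma starDr : right_distributive star +%R.
Proof. by move=> c a b; rewrite -[a]scale1r star_linr !scale1r. Qed.

Lemma star0l a : star 0 a = 0.
Proof. by apply: (addrI (star 0 a)); rewrite -starDl !addr0. Qed.

Lemma star0r a : star a 0 = 0.
Proof. by apply: (addrI (star a 0)); rewrite -starDr !addr0. Qed.

Lemma starZl k a b : k *: star a b = star (k *: a) b.
Proof. by rewrite -[k *: a]addr0 star_linl star0l addr0. Qed.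

Lemma starZr k a b : k *: star a b = star a (k *: b).
Proof. by rewrite -[k *: b]addr0 star_linr star0r addr0. Qed.

Lemma starE g h a b : gA g a -> gA h b -> star a b = s g h *: (a * b).
Proof.
move=> ha hb.
pose r := undup (g :: hsupp gA a); pose t := undup (h :: hsupp gA b).
have ur : uniq r by apply: undup_uniq.
have ut : uniq t by apply: undup_uniq.
rewrite (@starW r t) //; first last.
- by move=> x hx; rewrite mem_undup inE hx orbT.
- by move=> x hx; rewrite mem_undup inE hx orbT.
rewrite (bigD1_seq g) ?mem_undup ?inE ?eqxx //=.
rewrite (bigD1_seq h) ?mem_undup ?inE ?eqxx //=.
rewrite !(hcomp_homog _ ha) !(hcomp_homog _ hb) !eqxx.
rewrite !big1 ?addr0 // => [x /negbTE nx|x /negbTE nx].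
  apply: big1 => y _.
  by rewrite (hcomp_homog _ ha) nx mul0r scaler0.
by rewrite (hcomp_homog _ hb) nx mulr0 scaler0.
Qed.

Lemma star_gr g h a b : gA g a -> gA h b -> gA (g + h) (star a b).
Proof. by move=> ha hb; rewrite (starE ha hb); apply/grZ/grM. Qed.

Lemma starA : associative star.
Proof.
move=> a b c; elim/(@hcomp_ind _ _ _ gA): a => [|a a' ea ea'|g a ha].
- by rewrite !star0l.
- by rewrite !starDl ea ea'.
elim/(@hcomp_ind _ _ _ gA): b => [|b b' eb eb'|h b hb].
- by rewrite star0l star0r star0l.
- by rewrite starDl !starDr starDl eb eb'.
elim/(@hcomp_ind _ _ _ gA): c => [|c c' ec ec'|k c hc].
- by rewrite !star0r.
- by rewrite !starDr ec ec'.
rewrite (starE ha (star_gr hb hc)) (starE (star_gr ha hb) hc).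
rewrite (starE ha hb) (starE hb hc) -scalerAl -scalerAr !scalerA mulrA.
by rewrite bicharDl bicharDr; congr (_ *: _); rewrite -mulrA mulrC.
Qed.

Lemma star1l : left_id 1 star.
Proof.
move=> a; elim/(@hcomp_ind _ _ _ gA): a => [|a a' ea ea'|g a ha].
- by rewrite star0r.
- by rewrite starDr ea ea'.
- by rewrite (starE (gr1 gA) ha) bichar0l scale1r mul1r.
Qed.

Lemma star1r : right_id 1 star.
Proof.
move=> a; elim/(@hcomp_ind _ _ _ gA): a => [|a a' ea ea'|g a ha].
- by rewrite star0l.
- by rewrite starDl ea ea'.
- by rewrite (starE ha (gr1 gA)) bichar0r scale1r mulr1.
Qed.

HB.instance Definition _ := GRing.Lmodule.copy (twisted gA s) A.
HB.instance Definition _ := GRing.Zmodule_isNzRing.Build (twisted gA s)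
  starA star1l star1r starDl starDr (oner_neq0 A).
HB.instance Definition _ := GRing.Lmodule_isLalgebra.Build K (twisted gA s)
  starZl.
HB.instance Definition _ := GRing.Lalgebra_isAlgebra.Build K (twisted gA s)
  starZr.

Lemma twistedM g h (a b : twisted gA s) :
  gA g (untwist a) -> gA h (untwist b) ->
  untwist (a * b) = s g h *: (untwist a * untwist b).
Proof. exact: starE. Qed.

End Star.

Section Inverses.
Variable R : pzRingType.

Definition invertible (a : R) : Prop := exists b, a * b = 1 /\ b * a = 1.

(* The two-sided inverse of a if there is one, and 0 otherwise. It is applied *)
(* to the ring R and to the matrix rings 'M[R]_n, where R need not be         *)
(* commutative.                                                               *)
Definition rinv (a : R) : R := xget 0 [set b | a * b = 1 /\ b * a = 1].

End Inverses.

Definition unit_subgroup (R : pzRingType) (P : R -> Prop) : Prop :=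
  [/\ P 1, forall a b, P a -> P b -> P (a * b)
    & forall a, P a -> exists b, [/\ P b, a * b = 1 & b * a = 1]].

Definition group_morphism (R S : pzRingType) (P : R -> Prop) (Q : S -> Prop)
    (f : R -> S) : Prop :=
  [/\ unit_subgroup P, unit_subgroup Q, forall a, P a -> Q (f a)
    & forall a b, P a -> P b -> f (a * b) = f a * f b].

Section Berezinian.
Variables (R : pzRingType) (r0 r1 : nat).

(* X_00 - X_01 X_11^-1 X_10 *)
Definition schur (X : 'M[R]_(r0 + r1)) : 'M[R]_r0 :=
  ulsubmx X - ursubmx X *m rinv (drsubmx X) *m dlsubmx X.

(* For an even supermatrix, the two determinants are over the commutative     *)
(* even part of R: \det is the Leibniz formula, which makes sense in R.       *)
Definition Ber (X : 'M[R]_(r0 + r1)) : R :=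
  \det (schur X) * rinv (\det (drsubmx X)).

End Berezinian.

Section GradedMatrices.
Variables (K : fieldType) (G : zmodType) (A : algType K) (gA : grading G A).

Definition mx_homog n (nu : 'I_n -> G) (x : G) (X : 'M[A]_n) : Prop :=
  forall i j, gA (x - nu i + nu j) (X i j).

Definition GLhom n (nu : 'I_n -> G) (x : G) (X : 'M[A]_n) : Prop :=
  mx_homog nu x X /\ invertible X.

Definition Jmx (s : bicharacter K G) n (nu : 'I_n -> G) (x : G)
    (X : 'M[A]_n) : 'M[twisted gA s]_n :=
  \matrix_(i, j) ((s x (nu j) * (s (nu i) (x - nu i + nu j))^-1) *:
                  (X i j : twisted gA s)).

Definition join_deg r0 r1 (nu0 : 'I_r0 -> G) (nu1 : 'I_r1 -> G)
    (i : 'I_(r0 + r1)) : G :=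
  match split i with inl i0 => nu0 i0 | inr i1 => nu1 i1 end.

Definition GDet (s : bicharacter K G) n (nu : 'I_n -> G) (x : G)
    (X : 'M[A]_n) : A :=
  untwist (\det (Jmx s nu x X)).

Definition GBer (s : bicharacter K G) r0 r1 (nu0 : 'I_r0 -> G)
    (nu1 : 'I_r1 -> G) (x : G) (X : 'M[A]_(r0 + r1)) : A :=
  untwist (Ber (Jmx s (join_deg nu0 nu1) x X)).

Variable lam : bicharacter K G.

(* The elements all of whose nonzero components have parity p. *)
Definition super_part (p : bool) (a : A) : Prop :=
  forall g, hcomp gA a g != 0 -> odd_deg lam g = p.

Definition even_supermx (s : bicharacter K G) r0 r1
    (Y : 'M[twisted gA s]_(r0 + r1)) : Prop :=
  [/\ forall i j, super_part false (untwist (ulsubmx Y i j)),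
      forall i j, super_part true (untwist (ursubmx Y i j)),
      forall i j, super_part true (untwist (dlsubmx Y i j))
    & forall i j, super_part false (untwist (drsubmx Y i j))].

End GradedMatrices.

(* Main.v *)
Require Import Defs.
From HB Require Import structures.
From mathcomp Require Import all_boot all_order all_algebra.
From mathcomp Require Import fingroup perm boolp classical_sets ring.

Set Implicit Arguments.
Unset Strict Implicit.
Unset Printing Implicit Defensive.

Import Order.TTheory GRing.Theory Num.Theory.
Local Open Scope ring_scope.

(* With J_s extended to rectangular matrices by the same formula,             *)
(* J_s(X) J_s(Z) = s(x, z) J_s(XZ). Hence J_s is multiplicative in degree 0,  *)
(* it preserves invertibility, and it commutes with Schur complements in      *)
(* every degree x; so Ber (J_s X) is a product of two graded determinants,    *)
(* and the power of s(x, x) comes from comparing the product and the inverse  *)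
(* of elements of degrees r0 x and r1 x in the two algebras. The block X_11   *)
(* is invertible because X_11 (X^-1)_11 = 1 - X_10 (X^-1)_01, where the       *)
(* entries a of X_10 satisfy a b a = 0 for all b. Multiplicativity of Ber is  *)
(* obtained from the LDU decomposition, which reduces it to                   *)
(* det (1 + PQ) det (1 + QP) = 1 for odd matrices P and Q.                    *)
(* For the independence of s, let q = s'/s, a symmetric bicharacter. On the   *)
(* term of a permutation p, the reordering factor is the product over i < j   *)
(* of q(g_i, g_j), with g_i = nu_(p i) - nu_i. Expanding it bilinearly, and   *)
(* using that the product of the q(nu_i, nu_j) over i < j does not depend on  *)
(* the order of the nu_i, gives the product of the q(nu_i, g_i), which is     *)
(* cancelled by the coefficients of J_s.                                      *)

(** By [Jmx2_mul], J_s is multiplicative up to the scalar s(x, z), so graded statements over A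
    become statements of supercommutative linear algebra over [twisted gA s]. [GLhom_drsub] makes
    the Berezinian of J_s(X) meaningful, [schur_Jmx] expresses it through two graded determinants,
    and [GBerE] compares products and inverses in the two algebras. In degree 0 the scalars are 1:
    [GBer_mul] then follows from [Ber_mul], and independence of s from [GDet_indep], applied to each
    of the two determinants. *)

Section TwoSidedInverse.
Variable R : pzRingType.

(** Two-sided inverses are unique, so any exhibited one is the element picked by [xget]. *)
Lemma rinvE (a b : R) : a * b = 1 -> b * a = 1 -> rinv a = b.
Proof.
move=> ab ba; rewrite /rinv; case: xgetP => [c _ [ac ca]|/(_ b)[]//].
by rewrite -[c]mul1r -ba -mulrA ac mulr1.
Qed.

Lemma rinvP (a : R) : invertible a -> a * rinv a = 1 /\ rinv a * a = 1.
Proof. by case=> b [ab ba]; rewrite (rinvE ab ba). Qed.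

Lemma invertibleM (a b : R) : invertible a -> invertible b -> invertible (a * b).
Proof.
move=> [a' [aa' a'a]] [b' [bb' b'b]]; exists (b' * a'); split.
  by rewrite mulrA -(mulrA a) bb' mulr1.
by rewrite mulrA -(mulrA b') a'a mulr1.
Qed.

Lemma invertible_lr (a b c : R) : a * b = 1 -> c * a = 1 -> invertible a.
Proof.
move=> ab ca; exists b; split=> //; suff -> : b = c by [].
by rewrite -[b]mul1r -ca -mulrA ab mulr1.
Qed.

(** Here [a * b] supplies a right inverse of [a] and [c * a] a left one; in a noncommutative ring
    both are required. *)
Lemma invertible_factor (a b c : R) :
  invertible (a * b) -> invertible (c * a) -> invertible a.
Proof.
move=> [u [abu _]] [v [_ vca]].
by apply: (@invertible_lr _ (b * u) (v * c)); rewrite ?mulrA // -mulrA.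
Qed.

(** True by conversion; it exposes [*m], on which the matrix lemmas rewrite. *)
Lemma invertible_mxP n (M : 'M[R]_n) :
  invertible M <-> exists N, M *m N = 1%:M /\ N *m M = 1%:M.
Proof. by []. Qed.

Lemma sqr0_mulmx n (y : 'M[R]_n) : y *m y = 0 ->
  (1%:M + y) *m (1%:M - y) = 1%:M /\ (1%:M - y) *m (1%:M + y) = 1%:M.
Proof.
move=> yy; split.
  by rewrite mulmxDl mul1mx mulmxBr mulmx1 yy subr0 subrK.
by rewrite mulmxBl mul1mx mulmxDr mulmx1 yy addr0 addrK.
Qed.

(* Subtracting one entry of P at a time multiplies the matrix by 1 - y with   *)
(* y ^ 2 = 0.                                                                 *)
Lemma invertible_subr_sandwich m n (P : 'M[R]_(m, n)) (Q : 'M[R]_(n, m)) :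
  (forall i j a, P i j * a * P i j = 0) -> invertible (1%:M - P *m Q).
Proof.
move=> hP; rewrite [P]matrix_sum_delta pair_bigA /=.
elim/big_rec: _ => [|[i j] P' _ /invertible_mxP[M [eM Me]]] /=; apply/invertible_mxP.
  by exists 1%:M; rewrite mul0mx subr0 mulmx1.
set E := _ *: _; pose y := M *m (E *m Q).
have -> : 1%:M - (E + P') *m Q = (1%:M - P' *m Q) *m (1%:M - y).
  rewrite mulmxBr mulmx1 /y mulmxA eM mul1mx mulmxDl.
  by rewrite [E *m Q + _]addrC opprD addrA.
have EE (N : 'M_(n, m)) : E *m N *m E = 0.
  apply/matrixP => k l; rewrite !mxE big1 // => p _; rewrite !mxE.
  rewrite (bigD1 j) //= big1 => [|q qj]; last by rewrite !mxE (negbTE qj) andbF mulr0 mul0r.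
  rewrite !mxE eqxx andbT addr0.
  case: (k == i); last by rewrite mulr0 !mul0r.
  case: (_ && _); last by rewrite !mulr0.
  by rewrite !mulr1 hP.
have yy : y *m y = 0.
  have -> : y *m y = M *m (E *m (Q *m M) *m E *m Q) by rewrite /y !mulmxA.
  by rewrite EE mul0mx mulmx0.
have [y2 y1] := sqr0_mulmx yy.
exists ((1%:M + y) *m M); split.
  by rewrite mulmxA -(mulmxA _ (1%:M - y)) y1 mulmx1.
by rewrite mulmxA -(mulmxA _ M) Me mulmx1.
Qed.

End TwoSidedInverse.

(** * Matrices with central entries *)

Section Center.
Variable R : nzRingType.

Definition central (a : R) : Prop := forall b, a * b = b * a.

Definition central_pred : {pred R} := fun a => `[< central a >].

Lemma centralP a : reflect (central a) (a \in central_pred).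
Proof. exact: asboolP. Qed.

Lemma central_subring : subring_closed central_pred.
Proof.
split=> [|a b /centralP ca /centralP cb|a b /centralP ca /centralP cb]; apply/centralP => c.
- by rewrite mul1r mulr1.
- by rewrite mulrBl mulrBr ca cb.
- by rewrite -mulrA cb mulrA ca mulrA.
Qed.

HB.instance Definition _ := GRing.isSubringClosed.Build R central_pred central_subring.

(** The center as a commutative ring: a matrix with central entries is the image of a matrix over
    [center], and determinant identities over commutative rings are transferred along [val]. *)
Record center := Center { center_val : R; _ : center_val \in central_pred }.

HB.instance Definition _ := [isSub for center_val].
HB.instance Definition _ := [Choice of center by <:].
HB.instance Definition _ := [SubChoice_isSubNzRing of center by <:].

Fact center_mulC : commutative (@GRing.mul center).
Proof. by move=> a b; apply: val_inj; rewrite !rmorphM /=; case: a => a /= /centralP ->. Qed.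

HB.instance Definition _ := GRing.PzRing_hasCommutativeMul.Build center center_mulC.

Lemma central1 : central 1. Proof. exact/centralP/rpred1. Qed.
Lemma central0 : central 0. Proof. exact/centralP/rpred0. Qed.
Lemma centralD a b : central a -> central b -> central (a + b).
Proof. by move=> /centralP ha /centralP hb; apply/centralP/rpredD. Qed.
Lemma centralN a : central a -> central (- a).
Proof. by move=> ha b; rewrite mulrN mulNr ha. Qed.
Lemma centralM a b : central a -> central b -> central (a * b).
Proof. by move=> /centralP ha /centralP hb; apply/centralP/rpredM. Qed.
Lemma central_sum I (r : seq I) (F : I -> R) :
  (forall i, central (F i)) -> central (\sum_(i <- r) F i).
Proof. by move=> hF; elim/big_ind: _ => //; [apply: central0 | apply: centralD]. Qed.

Definition central_mx m n (M : 'M[R]_(m, n)) : Prop := forall i j, central (M i j).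

Lemma central_mxP m n (M : 'M[R]_(m, n)) :
  central_mx M -> exists N : 'M[center]_(m, n), M = map_mx val N.
Proof.
move=> hM; exists (\matrix_(i, j) Center (introT (centralP _) (hM i j))).
by apply/matrixP => i j; rewrite !mxE.
Qed.

Lemma central_mx1 n : central_mx (1%:M : 'M_n).
Proof. by move=> i j; rewrite mxE; case: eqP => _; [apply: central1|apply: central0]. Qed.

Lemma central_mxD m n (M N : 'M[R]_(m, n)) :
  central_mx M -> central_mx N -> central_mx (M + N).
Proof. by move=> hM hN i j; rewrite mxE; apply: centralD. Qed.

Lemma central_mxN m n (M : 'M[R]_(m, n)) : central_mx M -> central_mx (- M).
Proof. by move=> hM i j; rewrite mxE; apply: centralN. Qed.

Lemma central_mulmx m n p (M : 'M[R]_(m, n)) (N : 'M_(n, p)) :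
  central_mx M -> central_mx N -> central_mx (M *m N).
Proof. by move=> hM hN i j; rewrite mxE; apply: central_sum => k; apply: centralM. Qed.

Lemma central_scalarP n (M : 'M[R]_n) (a : R) : central_mx M -> a%:M *m M = M *m a%:M.
Proof.
move=> hM; rewrite mul_scalar_mx; apply/matrixP => i j; rewrite !mxE.
rewrite (bigD1 j) //= big1 => [|k kj]; last by rewrite mxE (negbTE kj) mulr0.
by rewrite mxE eqxx addr0 hM.
Qed.

(** The scalar matrix of any element a commutes with M, so aN = NMaN = NaMN = Na; comparing entries
    shows that a commutes with those of N. *)
Lemma central_mx_inv n (M N : 'M[R]_n) :
  M *m N = 1%:M -> N *m M = 1%:M -> central_mx M -> central_mx N.
Proof.
move=> MN NM hM i j a.
have : a%:M *m N = N *m a%:M.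
  rewrite -[a%:M *m N]mul1mx -NM -!mulmxA; congr (N *m _).
  by rewrite mulmxA -central_scalarP // -mulmxA MN mulmx1.
move=> /matrixP/(_ i j); rewrite mul_scalar_mx !mxE => ->.
rewrite (bigD1 j) //= big1 => [|k kj]; last by rewrite mxE (negbTE kj) mulr0.
by rewrite mxE eqxx addr0.
Qed.

Lemma central_det n (M : 'M[R]_n) : central_mx M -> central (\det M).
Proof. by case/central_mxP => N ->; rewrite det_map_mx; apply/centralP/valP. Qed.

Lemma central_detM n (M N : 'M[R]_n) :
  central_mx M -> central_mx N -> \det (M *m N) = \det M * \det N.
Proof.
case/central_mxP => M' -> /central_mxP[N' ->].
by rewrite -map_mxM !det_map_mx det_mulmx rmorphM.
Qed.

End Center.

(** Sylvester's identity: the block matrix with rows (1, -A) and (B, 1) is factored into block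
    triangular matrices in two ways. *)
Lemma det_add1_mulC (R : comPzRingType) m n (A : 'M[R]_(m, n)) (B : 'M_(n, m)) :
  \det (1%:M + A *m B) = \det (1%:M + B *m A).
Proof.
have e1 : block_mx 1%:M 0 B 1%:M *m block_mx 1%:M (- A) 0 (1%:M + B *m A)
   = block_mx 1%:M (- A) B 1%:M.
  rewrite mulmx_block !mul1mx ?mul0mx ?mulmx0 ?mulmx1 !addr0.
  by rewrite mulmxN [1%:M + _]addrC addrA addNr add0r.
have e2 : block_mx 1%:M (- A) 0 1%:M *m block_mx (1%:M + A *m B) 0 B 1%:M
   = block_mx 1%:M (- A) B 1%:M.
  rewrite mulmx_block !mul1mx ?mul0mx ?mulmx0 ?mulmx1 !add0r.
  by rewrite mulNmx addrK.
have := congr1 determinant (etrans e1 (esym e2)).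
by rewrite !det_mulmx !det_ublock !det_lblock !det1 !mul1r !mulr1 => ->.
Qed.

Lemma central_det_add1_mulC (R : nzRingType) m n (A : 'M[R]_(m, n)) (B : 'M_(n, m)) :
  central_mx A -> central_mx B -> \det (1%:M + A *m B) = \det (1%:M + B *m A).
Proof.
case/central_mxP => M -> /central_mxP[N ->].
have e k l (S : 'M[center R]_(k, l)) T :
    1%:M + map_mx val S *m map_mx val T = map_mx val (1%:M + S *m T).
  by rewrite map_mxD map_mx1 map_mxM.
by rewrite !e !det_map_mx det_add1_mulC.
Qed.

Lemma det_id (R : nzRingType) n : \det (1%:M : 'M[R]_n) = 1.
Proof.
have -> : 1%:M = map_mx val (1%:M : 'M[center R]_n) by rewrite map_mx1.
by rewrite det_map_mx det1 rmorph1.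
Qed.

(** * Multiplicativity of the Berezinian *)

(** The properties of odd elements used for the Berezinian. [odd_sqr] is listed separately because
    anticommutation alone only gives 2 a a = 0. *)
Record odd_module (R : nzRingType) (O : R -> Prop) : Prop := OddModule {
  odd0 : O 0;
  oddD : forall a b, O a -> O b -> O (a + b);
  oddZ : forall c a, central c -> O a -> O (c * a);
  oddC : forall a b, O a -> O b -> a * b = - (b * a);
  odd_sqr : forall a, O a -> a * a = 0;
  odd_central : forall a b, O a -> O b -> central (a * b) }.

Section OddMatrices.
Variables (R : nzRingType) (O : R -> Prop).
Hypothesis hO : odd_module O.

Definition odd_mx m n (M : 'M[R]_(m, n)) : Prop := forall i j, O (M i j).

Lemma odd_sum I (r : seq I) (F : I -> R) : (forall i, O (F i)) -> O (\sum_(i <- r) F i).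
Proof. by move=> hF; elim/big_ind: _ => //; [apply: odd0 | apply: oddD]. Qed.

Lemma odd_mxD m n (M N : 'M[R]_(m, n)) : odd_mx M -> odd_mx N -> odd_mx (M + N).
Proof. by move=> hM hN i j; rewrite mxE; apply: oddD. Qed.

Lemma odd_mulmxl m n p (M : 'M[R]_(m, n)) (N : 'M_(n, p)) :
  central_mx M -> odd_mx N -> odd_mx (M *m N).
Proof. by move=> hM hN i j; rewrite mxE; apply: odd_sum => k; apply: oddZ. Qed.

Lemma odd_mulmxr m n p (M : 'M[R]_(m, n)) (N : 'M_(n, p)) :
  odd_mx M -> central_mx N -> odd_mx (M *m N).
Proof.
by move=> hM hN i j; rewrite mxE; apply: odd_sum => k; rewrite -hN; apply: oddZ.
Qed.

Lemma odd_mulmx m n p (M : 'M[R]_(m, n)) (N : 'M_(n, p)) :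
  odd_mx M -> odd_mx N -> central_mx (M *m N).
Proof.
by move=> hM hN i j; rewrite mxE; apply: central_sum => k; apply: (odd_central hO).
Qed.

(** A column times a row: through such a rank one factorisation, Sylvester's identity reduces a
    determinant to one of size 1. *)
Lemma delta_mulmxE m n p (Q : 'M[R]_(n, p)) (b : R) i j :
  (b *: delta_mx i j : 'M_(m, n)) *m Q = delta_mx i 0 *m (b *: row j Q).
Proof.
apply/matrixP => k l; rewrite !mxE big_ord1 !mxE (bigD1 j) //= big1 => [|q qj].
  by rewrite !mxE !eqxx !andbT addr0; case: (k == i); rewrite !(mulr1, mulr0, mul1r, mul0r).
by rewrite !mxE (negbTE qj) andbF mulr0 mul0r.
Qed.

Lemma mulmx_deltaE m n p (Q : 'M[R]_(p, m)) (b : R) i j :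
  Q *m (b *: delta_mx i j : 'M_(m, n)) = (Q *m (b *: delta_mx i 0 : 'cV_m)) *m delta_mx 0 j.
Proof. by rewrite -mulmxA -scalemxAl mul_delta_mx. Qed.

Lemma mulmx_delta_col m p (Q : 'M[R]_(p, m)) (b : R) i j :
  (Q *m (b *: delta_mx i 0 : 'cV_m)) j 0 = Q j i * b.
Proof.
rewrite mxE (bigD1 i) //= big1 => [|q qi]; first by rewrite !mxE !eqxx mulr1 addr0.
by rewrite !mxE (negbTE qi) mulr0 mulr0.
Qed.

Lemma central_delta m n i j : central_mx (delta_mx i j : 'M[R]_(m, n)).
Proof. by move=> k l; rewrite mxE; case: (_ && _); [apply: central1|apply: central0]. Qed.

Lemma det_mx1 (M : 'M[R]_1) : \det M = M 0 0.
Proof.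
rewrite /determinant (bigD1 (1%g : 'S_1)) //= [X in _ + X]big1 => [|s s1]; last first.
  suff e : s = 1%g by rewrite e eqxx in s1.
  by apply/permP => i; rewrite !ord1.
by rewrite odd_perm1 mul1r big_ord1 perm1 addr0.
Qed.

Lemma det_add1_mulmx_delta m n (Q : 'M[R]_(n, m)) (b : R) i j :
  odd_mx Q -> O b -> \det (1%:M + Q *m (b *: delta_mx i j)) = 1 + Q j i * b.
Proof.
move=> hQ hb; rewrite mulmx_deltaE central_det_add1_mulC; last exact: central_delta.
  by rewrite det_mx1 -rowE 2!mxE eqxx [row _ _ _ _]mxE mulmx_delta_col.
apply: odd_mulmx => // k l; rewrite !mxE.
by case: (_ && _); rewrite ?mulr1 ?mulr0 //; apply: odd0.
Qed.

Lemma det_add1_delta_mulmx m n (Q : 'M[R]_(n, m)) (b : R) i j :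
  odd_mx Q -> O b -> \det (1%:M + (b *: delta_mx i j) *m Q) = 1 + b * Q j i.
Proof.
move=> hQ hb; rewrite delta_mulmxE central_det_add1_mulC; first last.
- by move=> k l; rewrite !mxE; apply: (odd_central hO).
- exact: central_delta.
- by rewrite det_mx1 -colE !mxE eqxx.
Qed.

Lemma delta_mulmx_delta m n (Q : 'M[R]_(n, m)) (b : R) i j :
  (b *: delta_mx i j : 'M_(m, n)) *m Q *m (b *: delta_mx i j) =
  (b * Q j i * b) *: delta_mx i j.
Proof.
rewrite delta_mulmxE -mulmxA mulmx_deltaE mulmxA.
rewrite [X in _ *m X *m _](_ : _ = (b * Q j i * b)%:M).
  apply/matrixP => k l; rewrite !mxE big_ord1 !mxE (bigD1 0) //= big1 ?addr0 => [|q].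
    rewrite !mxE !eqxx !andbT /=.
    by case: (k == i); case: (l == j); rewrite !(mulr1, mulr0, mul1r, mul0r).
  by rewrite ord1.
apply/matrixP => k l; rewrite !ord1 mxE (bigD1 i) //= big1 => [|q qi].
  by rewrite !mxE !eqxx mulr1 addr0.
by rewrite !mxE (negbTE qi) mulr0 mulr0.
Qed.

(* Adding an entry b at (i, j) to P multiplies the two determinants by        *)
(* 1 + b q and 1 + q b, where q is the entry (j, i) of (1 + QP)^-1 Q; the     *)
(* product of these is 1 - (b q) ^ 2 = 1.                                     *)
Lemma odd_det_add1_mul m n (P : 'M[R]_(m, n)) (Q : 'M[R]_(n, m)) :
  odd_mx P -> odd_mx Q ->
  (exists M, (1%:M + Q *m P) *m M = 1%:M /\ M *m (1%:M + Q *m P) = 1%:M) /\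
  \det (1%:M + P *m Q) * \det (1%:M + Q *m P) = 1.
Proof.
(* Oddness is carried along because the induction replaces P by partial sums of its entries. *)
move=> hP hQ; suff: odd_mx P /\
    (exists M, (1%:M + Q *m P) *m M = 1%:M /\ M *m (1%:M + Q *m P) = 1%:M) /\
    \det (1%:M + P *m Q) * \det (1%:M + Q *m P) = 1 by case.
rewrite [P]matrix_sum_delta pair_bigA /=.
elim/big_rec: _ => [|[i j] P' _ [hP' [[M [eM Me]] dP']]] /=.
  rewrite mulmx0 mul0mx !addr0 !det_id mulr1; split.
    by move=> i j; rewrite mxE; apply: odd0.
  by split=> //; exists 1%:M; rewrite mulmx1.
set b := P i j; set E := b *: _; pose q := M *m Q.
have hb : O b by apply: hP.
have cM : central_mx M.
  by apply: (central_mx_inv eM Me); apply: central_mxD; [apply: central_mx1 | apply: odd_mulmx].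
have hq : odd_mx q by apply: odd_mulmxl.
have hE : odd_mx E.
  move=> k l; rewrite !mxE; case: (_ && _); rewrite ?mulr1 ?mulr0 //; exact: odd0.
(* Since (1 + QP')Q = Q(1 + P'Q), the matrix q is also Q(1 + P'Q)^-1; the two forms of q give the
   factorisations [e1] and [e2]. *)
have eQ : q *m (1%:M + P' *m Q) = Q.
  have -> : q *m (1%:M + P' *m Q) = M *m ((1%:M + Q *m P') *m Q).
    by rewrite mulmxDr mulmxDl mul1mx mulmx1 /q mulmxDr !mulmxA.
  by rewrite mulmxA Me mul1mx.
have e1 : 1%:M + Q *m (E + P') = (1%:M + Q *m P') *m (1%:M + q *m E).
  rewrite mulmxDr mulmx1 /q -mulmxA [_ *m (M *m _)]mulmxA eM mul1mx mulmxDr.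
  by rewrite [Q *m E + _]addrC addrA.
have e2 : 1%:M + (E + P') *m Q = (1%:M + E *m q) *m (1%:M + P' *m Q).
  rewrite [RHS]mulmxDl mul1mx -mulmxA eQ mulmxDl.
  by rewrite [E *m Q + _]addrC addrA.
have bqb : b * q j i * b = 0.
  by rewrite (oddC hO hb (hq j i)) mulNr -mulrA (odd_sqr hO hb) mulr0 oppr0.
have EqE : E *m q *m E = 0 by rewrite delta_mulmx_delta bqb scale0r.
split; first exact: odd_mxD.
split.
  have y2 : (q *m E) *m (q *m E) = 0 by rewrite -mulmxA (mulmxA E) EqE mulmx0.
  have [z1 z2] := sqr0_mulmx y2.
  exists ((1%:M - q *m E) *m M); rewrite e1; split.
    by rewrite mulmxA -(mulmxA _ (1%:M + q *m E)) z1 mulmx1.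
  by rewrite mulmxA -(mulmxA _ M) Me mulmx1.
have c1 : central_mx (1%:M + Q *m P').
  by apply: central_mxD; [apply: central_mx1 | apply: odd_mulmx].
have c2 : central_mx (1%:M + P' *m Q).
  by apply: central_mxD; [apply: central_mx1 | apply: odd_mulmx].
have c3 : central_mx (1%:M + q *m E).
  by apply: central_mxD; [apply: central_mx1 | apply: odd_mulmx].
have c4 : central_mx (1%:M + E *m q).
  by apply: central_mxD; [apply: central_mx1 | apply: odd_mulmx].
rewrite e1 e2 !central_detM // -mulrA (mulrA (\det (1%:M + P' *m Q))) dP' mul1r.
rewrite det_add1_mulmx_delta // det_add1_delta_mulmx //.
rewrite mulrDl mul1r mulrDr mulr1 (mulrA (b * _)) -(mulrA b) .
have -> : q j i * q j i = 0 by apply: (odd_sqr hO).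
rewrite mulr0 mul0r addr0 -addrA [b * _](oddC hO) //.
by rewrite subrr addr0.
Qed.

Lemma rinv_det n (D D' : 'M[R]_n) : central_mx D ->
  D *m D' = 1%:M -> D' *m D = 1%:M -> rinv (\det D) = \det D'.
Proof.
move=> cD e e'; have cD' := central_mx_inv e e' cD.
by apply: rinvE; rewrite -central_detM // ?e ?e' det_id.
Qed.

(** * Triangular factorisation of supermatrices *)

Section Ber.
Variables r0 r1 : nat.

(** The expanded product of the unipotent upper factor of P, the diagonal blocks S and D, and the
    unipotent lower factor of Q. *)
Definition LDU_mx (P : 'M[R]_(r0, r1)) (S : 'M_r0) (D : 'M_r1) (Q : 'M_(r1, r0)) :=
  block_mx (S + P *m D *m Q) (P *m D) (D *m Q) D.

Definition super_mx (X : 'M[R]_(r0 + r1)) : Prop :=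
  [/\ central_mx (ulsubmx X), odd_mx (ursubmx X), odd_mx (dlsubmx X)
    & central_mx (drsubmx X)].

Lemma LDU_mxE X D' :
  drsubmx X *m D' = 1%:M -> D' *m drsubmx X = 1%:M ->
  X = LDU_mx (ursubmx X *m D') (schur X) (drsubmx X) (D' *m dlsubmx X).
Proof.
move=> e e'; rewrite /LDU_mx /schur (@rinvE _ (drsubmx X : 'M_r1) D' e e').
rewrite -(mulmxA _ D' (drsubmx X)) e' mulmx1 (mulmxA (drsubmx X)) e mul1mx.
by rewrite (mulmxA _ D') subrK submxK.
Qed.

Lemma Ber_LDU P S D Q D' : central_mx D -> D *m D' = 1%:M -> D' *m D = 1%:M ->
  Ber (LDU_mx P S D Q) = \det S * \det D'.
Proof.
move=> cD e e'; rewrite /Ber /schur block_mxKul block_mxKur block_mxKdl block_mxKdr.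
rewrite (rinv_det cD e e') (@rinvE _ (D : 'M_r1) D' e e').
by rewrite -(mulmxA _ D') (mulmxA D') e' mul1mx addrK.
Qed.

(** The inner product of the lower factor of Q1 and the upper factor of P2 has rows (1, P2) and (Q1,
    M) with M = 1 + Q1 P2. It factors in turn with diagonal blocks 1 - P2 M' Q1 and M; the new
    unipotent factors are then moved outwards past the diagonal ones. *)
Lemma LDU_mul P1 S1 D1 Q1 P2 S2 D2 Q2 D1' D2' M' :
  D1' *m D1 = 1%:M -> D2 *m D2' = 1%:M ->
  (1%:M + Q1 *m P2) *m M' = 1%:M -> M' *m (1%:M + Q1 *m P2) = 1%:M ->
  LDU_mx P1 S1 D1 Q1 *m LDU_mx P2 S2 D2 Q2 =
  LDU_mx (P1 + S1 *m P2 *m M' *m D1') (S1 *m (1%:M - P2 *m M' *m Q1) *m S2)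
    (D1 *m (1%:M + Q1 *m P2) *m D2) (Q2 + D2' *m M' *m Q1 *m S2).
Proof.
move=> e1 e2 eM Me; rewrite /LDU_mx mulmx_block; set M := 1%:M + _ in eM Me *.
have eD : D1 *m Q1 *m (P2 *m D2) + D1 *m D2 = D1 *m M *m D2.
  by rewrite /M mulmxDr mulmxDl mulmx1 addrC !mulmxA.
have eQ : D1 *m M *m D2 *m (Q2 + D2' *m M' *m Q1 *m S2) =
          D1 *m M *m D2 *m Q2 + D1 *m Q1 *m S2.
  rewrite mulmxDr; congr (_ + _); rewrite !mulmxA.
  by rewrite -(mulmxA _ D2) e2 mulmx1 -(mulmxA _ M) eM mulmx1.
have eP : (P1 + S1 *m P2 *m M' *m D1') *m (D1 *m M *m D2) =
          P1 *m (D1 *m M *m D2) + S1 *m P2 *m D2.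
  rewrite mulmxDl; congr (_ + _); rewrite !mulmxA.
  by rewrite -(mulmxA _ D1') e1 mulmx1 -(mulmxA _ M') Me mulmx1.
have e5 : S1 *m P2 *m D2 *m (Q2 + D2' *m M' *m Q1 *m S2) =
          S1 *m P2 *m D2 *m Q2 + S1 *m P2 *m M' *m Q1 *m S2.
  by rewrite mulmxDr !mulmxA -(mulmxA _ D2 D2') e2 mulmx1.
congr block_mx => //.
- rewrite eP (mulmxDl (P1 *m (D1 *m M *m D2))) -(mulmxA P1 (D1 *m M *m D2)) eQ e5 -eD.
  rewrite !(mulmxDl, mulmxDr, mulmxN, mulNmx) mulmx1 !mulmxA.
  set b := S1 *m P2 *m D2 *m Q2; set f := S1 *m P2 *m M' *m Q1 *m S2.
  rewrite (addrC b f) (addrCA _ f) (addrA _ f) subrK -!addrA; congr (_ + _).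
  by rewrite !addrA [RHS](ACl (4*3*1*2)).
- by rewrite eP -eD mulmxDl mulmxDr !mulmxA -addrA addrC.
- by rewrite eQ -eD mulmxDr mulmxDl !mulmxA -addrA addrC.
Qed.

(** By [LDU_mul], the Schur complements and the lower right blocks multiply up to the middle factors
    1 - P M' Q and 1 + QP. These have the same determinant, so they cancel in the quotient. *)
Lemma Ber_mul X Z : super_mx X -> super_mx Z ->
  invertible (drsubmx X) -> invertible (drsubmx Z) ->
  Ber (X *m Z) = Ber X * Ber Z.
Proof.
move=> [X00 X01 X10 X11] [Z00 Z01 Z10 Z11].
move=> /invertible_mxP[D [eD De]] /invertible_mxP[F [eF Fe]].
have cD := central_mx_inv eD De X11; have cF := central_mx_inv eF Fe Z11.
have oP : odd_mx (ursubmx Z *m F) by apply: odd_mulmxr.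
have oQ : odd_mx (D *m dlsubmx X) by apply: odd_mulmxl.
have [[M' [eM Me]] dM] := odd_det_add1_mul oP oQ.
have cS : central_mx (schur X).
  rewrite /schur (@rinvE _ (drsubmx X : 'M_r1) D eD De).
  by apply: central_mxD => //; apply/central_mxN/odd_mulmx => //; apply: odd_mulmxr.
have cS' : central_mx (schur Z).
  rewrite /schur (@rinvE _ (drsubmx Z : 'M_r1) F eF Fe).
  by apply: central_mxD => //; apply/central_mxN/odd_mulmx => //; apply: odd_mulmxr.
have EX := LDU_mxE eD De; have EZ := LDU_mxE eF Fe.
have -> : Ber X = \det (schur X) * \det D by rewrite {1}EX (Ber_LDU _ _ _ X11 eD De).
have -> : Ber Z = \det (schur Z) * \det F by rewrite {1}EZ (Ber_LDU _ _ _ Z11 eF Fe).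
have := LDU_mul (ursubmx X *m D) (schur X) (schur Z) (F *m dlsubmx Z) De eF eM Me.
rewrite -EX -EZ => ->.
set P := ursubmx Z *m F in oP eM Me dM *; set Q := D *m dlsubmx X in oQ eM Me dM *.
clearbody P Q; have cQP : central_mx (1%:M + Q *m P).
  by apply: central_mxD; [apply: central_mx1 | apply: odd_mulmx].
have cPQ : central_mx (1%:M + P *m Q).
  by apply: central_mxD; [apply: central_mx1 | apply: odd_mulmx].
have cM' := central_mx_inv eM Me cQP.
have cS3 : central_mx (1%:M - P *m M' *m Q).
  apply: central_mxD; first exact: central_mx1.
  by apply/central_mxN/odd_mulmx => //; apply: odd_mulmxr.
rewrite (@Ber_LDU _ _ _ _ (F *m M' *m D)); first last.
- rewrite !mulmxA -(mulmxA _ D) De mulmx1 -(mulmxA _ M') Me mulmx1 //.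
- rewrite !mulmxA -(mulmxA _ (drsubmx Z) F) eF mulmx1 -(mulmxA _ (1%:M + Q *m P) M') eM mulmx1 //.
- by do 2!apply: central_mulmx => //.
have inv : (1%:M + P *m Q) *m (1%:M - P *m M' *m Q) = 1%:M.
  have e : (1%:M + P *m Q) *m P = P *m (1%:M + Q *m P).
    by rewrite mulmxDl mulmxDr mul1mx mulmx1 mulmxA.
  rewrite mulmxBr mulmx1 -mulmxA (mulmxA _ P) e -(mulmxA P) (mulmxA _ M') eM mul1mx.
  by rewrite addrK.
(* By [inv] the left side is inverse to det (1 + PQ), and by [dM] so is the right side. *)
have dS3 : \det (1%:M - P *m M' *m Q) = \det (1%:M + Q *m P).
  rewrite -[LHS]mul1r -[X in X * _]dM (central_det cPQ) -mulrA -central_detM // inv det_id.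
  by rewrite mulr1.
have dd : \det M' * \det (1%:M + Q *m P) = 1 by rewrite -central_detM // Me det_id.
rewrite !central_detM //; try by apply: central_mulmx.
rewrite dS3 -!mulrA; congr (_ * _).
rewrite (central_det cQP) -!mulrA (central_det cD (\det (1%:M + Q *m P))).
by rewrite (mulrA (\det M')) dd mul1r (central_det cD) mulrA.
Qed.

End Ber.
End OddMatrices.

(* Coefficients range over the whole center, which may contain odd elements:  *)
(* then inverses of matrices with central entries need no parity argument.    *)
Inductive odd_span (R : nzRingType) (S : R -> Prop) : R -> Prop :=
| odd_span0 : odd_span S 0
| odd_span_gen a : S a -> odd_span S a
| odd_spanD a b : odd_span S a -> odd_span S b -> odd_span S (a + b)
| odd_spanZ c a : central c -> odd_span S a -> odd_span S (c * a).

Lemma odd_span_module (R : nzRingType) (S : R -> Prop) :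
  (forall a b, S a -> S b -> a * b = - (b * a)) -> (forall a, S a -> a * a = 0) ->
  (forall a b, S a -> S b -> central (a * b)) -> odd_module (odd_span S).
Proof.
move=> SC S0 Sc.
(* Proved ahead of the other fields: the square of a sum vanishes because its cross terms
   anticommute. *)
have anti a b : odd_span S a -> odd_span S b -> a * b = - (b * a).
  elim=> {a} [|a Sa|a a' _ ea _ ea'|c a hc _ ea] hb.
  - by rewrite mul0r mulr0 oppr0.
  - elim: hb => {b} [|b Sb|b b' _ eb _ eb'|c b hc _ eb].
    + by rewrite mul0r mulr0 oppr0.
    + exact: SC.
    + by rewrite mulrDr mulrDl opprD eb eb'.
    + by rewrite mulrA -hc -mulrA eb mulrN mulrA.
  - by rewrite mulrDr mulrDl opprD ea // ea'.
  - by rewrite -mulrA ea // mulrN mulrA hc -mulrA -hc mulrA.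
split=> // [|a b|c a|a|a b].
- exact: odd_span0.
- exact: odd_spanD.
- exact: odd_spanZ.
- elim=> {a} [|a Sa|a b ha ea hb eb|c a hc ha ea].
  + by rewrite mul0r.
  + exact: S0.
  + by rewrite mulrDr !mulrDl ea eb add0r addr0 (anti a b) // subrr.
  + by rewrite mulrA -(mulrA c) -hc -!mulrA ea !mulr0.
- elim=> {a} [|a Sa|a a' _ ca _ ca'|c a hc _ ca] hb.
  + by rewrite mul0r; apply: central0.
  + elim: hb => {b} [|b Sb|b b' _ cb _ cb'|c b hc _ cb].
    * by rewrite mulr0; apply: central0.
    * exact: Sc.
    * by rewrite mulrDr; apply: centralD.
    * by rewrite mulrA -hc -mulrA; apply: centralM.
  + by rewrite mulrDl; apply: centralD; [apply: ca | apply: ca'].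
  + by rewrite -mulrA; apply: centralM => //; apply: ca.
Qed.

(** * Bicharacters *)

Section Bicharacters.
Variables (K : fieldType) (G : zmodType).
Implicit Types (s t : bicharacter K G) (x y : G).

Lemma bicharNl s x y : s (- x) y = (s x y)^-1.
Proof.
apply: (mulfI (bichar_neq0 s x y)).
by rewrite -bicharDl subrr bichar0l divff // bichar_neq0.
Qed.

Lemma bicharNr s x y : s x (- y) = (s x y)^-1.
Proof.
apply: (mulfI (bichar_neq0 s x y)).
by rewrite -bicharDr subrr bichar0r divff // bichar_neq0.
Qed.

Lemma bicharMnl s x y n : s (x *+ n) y = s x y ^+ n.
Proof.
by elim: n => [|n IHn]; rewrite ?mulr0n ?bichar0l // mulrSr bicharDl IHn exprSr.
Qed.

Lemma bicharMnr s x y n : s x (y *+ n) = s x y ^+ n.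
Proof.
by elim: n => [|n IHn]; rewrite ?mulr0n ?bichar0r // mulrSr bicharDr IHn exprSr.
Qed.

Definition bicharE s := (bicharDl s, bicharDr s, bicharNl s, bicharNr s).

(* The product of s (g_i, g_j) over i < j. *)
Fixpoint pairfac s (l : seq G) : K :=
  if l is g :: l' then s g (\sum_(h <- l') h) * pairfac s l' else 1.

Lemma pairfac_neq0 s l : pairfac s l != 0.
Proof. by elim: l => [|g l IHl] /=; rewrite ?oner_eq0 ?mulf_neq0 ?bichar_neq0. Qed.

(** Moving g to the front replaces factors s(h, g) by s(g, h), which are equal by symmetry. *)
Lemma pairfac_rem s (g : G) l : (forall x y, s x y = s y x) -> g \in l ->
  pairfac s l = pairfac s (g :: rem g l).
Proof.
move=> sC; elim: l => //= h l IHl; rewrite inE; have [->|gh] /= := eqVneq g h; first by [].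
move=> gl; rewrite IHl //= big_cons.
rewrite (perm_big _ (perm_to_rem gl)) big_cons /= !bicharDr (sC g h).
by rewrite -!mulrA; congr (_ * _); rewrite mulrCA.
Qed.

Lemma perm_pairfac s l l' : (forall x y, s x y = s y x) ->
  perm_eq l l' -> pairfac s l = pairfac s l'.
Proof.
move=> sC; elim: l l' => [|g l IHl] l' pl; first by move: (perm_size pl); case: l' {pl}.
have gl : g \in l' by rewrite -(perm_mem pl) mem_head.
have pr : perm_eq l (rem g l').
  by rewrite -(perm_cons g) (perm_trans pl) // perm_to_rem.
by rewrite (pairfac_rem sC gl) /= (IHl _ pr) (perm_big _ pr).
Qed.

(** Expanding over i < j yields, besides the factors in u alone and in v alone, the inverses of
    s(u_i, v_j) and s(v_i, u_j). By symmetry these run over all s(u_i, v_j) with i different from j,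
    that is, over s(sum u, sum v) without its diagonal terms. *)
Lemma pairfacB s I (r : seq I) (u v : I -> G) : (forall x y, s x y = s y x) ->
  pairfac s [seq u i - v i | i <- r] * s (\sum_(i <- r) u i) (\sum_(i <- r) v i) =
  pairfac s [seq u i | i <- r] * pairfac s [seq v i | i <- r] *
    \prod_(i <- r) s (v i) (u i).
Proof.
move=> sC; elim: r => [|i r IHr] /=; first by rewrite !big_nil bichar0l !mulr1.
rewrite !big_map !big_cons sumrB.
set U := \sum_(j <- r) u j in IHr *; set V := \sum_(j <- r) v j in IHr *.
set p := pairfac _ _ in IHr *; set pu := pairfac _ _ in IHr *.
set pv := pairfac _ _ in IHr *; set q := \prod_(_ <- _) _ in IHr *.
transitivity (s (u i) U * s (v i) V * s (v i) (u i) * (p * s U V)).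
  rewrite !bicharE (sC U (v i)) (sC (u i) (v i)); field.
  by rewrite !bichar_neq0.
by rewrite IHr; ring.
Qed.

(** [pairfacB] for u = nu o sg and v = nu is divided by the case u = v = nu, where the left factor
    is 1; the sums and the values of [pairfac] on u and v agree because only the order changes. *)
Lemma pairfac_permB s n (nu : 'I_n -> G) (sg : 'S_n) : (forall x y, s x y = s y x) ->
  pairfac s [seq nu (sg i) - nu i | i <- index_enum 'I_n] =
  \prod_i s (nu i) (nu (sg i) - nu i).
Proof.
move=> sC; set r := index_enum _.
have ps : perm_eq [seq nu (sg i) | i <- r] [seq nu i | i <- r].
  rewrite (map_comp nu sg); apply: perm_map; apply: uniq_perm.
  - by rewrite map_inj_uniq ?index_enum_uniq //; apply: perm_inj.
  - exact: index_enum_uniq.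
  - move=> i; rewrite mem_index_enum; apply/mapP; exists (sg^-1 i)%g.
      by rewrite mem_index_enum.
    by rewrite permKV.
have e1 := pairfacB r (fun i => nu (sg i)) nu sC.
have e2 := pairfacB r nu nu sC.
have z (l : seq 'I_n) : pairfac s [seq nu i - nu i | i <- l] = 1.
  elim: l => //= i l ->; rewrite big_map big1 => [|j _]; last exact: subrr.
  by rewrite bichar0r mulr1.
rewrite z mul1r in e2.
have es : \sum_(i <- r) nu (sg i) = \sum_(i <- r) nu i.
  by rewrite -(big_map (fun i => nu (sg i)) predT id) (perm_big _ ps) big_map.
rewrite es e2 (perm_pairfac sC ps) in e1.
set c := pairfac s [seq nu i | i <- r] in e1.
have cn : c != 0 by apply: pairfac_neq0.
have dn : \prod_(i <- r) s (nu i) (nu i) != 0.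
  by apply/prodf_neq0 => i _; apply: bichar_neq0.
rewrite mulrC -!mulrA in e1; move: (mulfI cn (mulfI cn e1)) => e3.
apply: (mulIf dn); rewrite mulrC e3 -big_split /=; apply: eq_bigr => i _.
by rewrite -bicharDr subrK.
Qed.

(** Closed by [Defined], so that its values reduce to quotients. *)
Definition bichar_ratio s t : bicharacter K G.
Proof.
exists (fun x y => s x y / t x y) => [x y|x y z|x y z].
- by rewrite mulf_neq0 ?invr_eq0 ?bichar_neq0.
- by rewrite !bicharDl invfM mulrACA.
- by rewrite !bicharDr invfM mulrACA.
Defined.

Lemma pairfac_ratio s t l : pairfac (bichar_ratio s t) l = pairfac s l / pairfac t l.
Proof. by elim: l => [|g l /= ->]; rewrite /= ?divr1 // invfM mulrACA. Qed.

End Bicharacters.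

(** * Homogeneous matrices *)

Section GradedInverse.
Variables (K : fieldType) (G : zmodType) (A : algType K) (gA : grading G A).

Lemma grN g a : gA g a -> gA g (- a).
Proof. by move=> ha; rewrite -scaleN1r; apply: grZ. Qed.

Lemma hcompD a b g : hcomp gA (a + b) g = hcomp gA a g + hcomp gA b g.
Proof. by rewrite -[a]scale1r hcomp_lin !scale1r. Qed.

Lemma hcomp0 g : hcomp gA 0 g = 0.
Proof. by rewrite (hcomp_homog _ (gr0 gA g)) if_same. Qed.

Lemma hcomp_big I (r : seq I) (F : I -> A) g :
  hcomp gA (\sum_(i <- r) F i) g = \sum_(i <- r) hcomp gA (F i) g.
Proof.
by elim: r => [|i r IHr]; rewrite ?big_nil ?hcomp0 // !big_cons hcompD IHr.
Qed.

Lemma hcomp_mull g h a b : gA g a -> hcomp gA (a * b) (g + h) = a * hcomp gA b h.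
Proof.
move=> ha; elim/(@hcomp_ind _ _ _ gA): b => [|b b' eb eb'|k b hb].
- by rewrite mulr0 !hcomp0 mulr0.
- by rewrite mulrDr !hcompD mulrDr eb eb'.
- rewrite (hcomp_homog _ (grM ha hb)) (hcomp_homog _ hb) (inj_eq (addrI g)).
  by case: eqP => // _; rewrite mulr0.
Qed.

Lemma deg_mul (x z g h k : G) : (x - g + h) + (z - h + k) = x + z - g + k.
Proof. by rewrite (addrC z) -(addrA (- h)) (addrA _ (- h)) addrK addrACA addrA. Qed.

Definition mx_homog2 m n (nu : 'I_m -> G) (mu : 'I_n -> G) (x : G) (X : 'M[A]_(m, n)) :=
  forall i j, gA (x - nu i + mu j) (X i j).

Lemma mx_homog2_mul m n p (nu : 'I_m -> G) (mu : 'I_n -> G) (rho : 'I_p -> G) x z X Z :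
  mx_homog2 nu mu x X -> mx_homog2 mu rho z Z -> mx_homog2 nu rho (x + z) (X *m Z).
Proof.
move=> hX hZ i k; rewrite mxE; apply: gr_sum => j.
by rewrite -(deg_mul _ _ _ (mu j)); apply: grM.
Qed.

(** Keeping only the components of the expected degree in the inverse still gives a right inverse,
    since X shifts degrees and the identity matrix is homogeneous of degree 0. Uniqueness of the
    inverse concludes. *)
Lemma mx_homog_inv n (nu : 'I_n -> G) x (X N : 'M[A]_n) : mx_homog gA nu x X ->
  X *m N = 1%:M -> N *m X = 1%:M -> mx_homog gA nu (- x) N.
Proof.
move=> hX XN NX.
pose N0 : 'M[A]_n := \matrix_(i, j) hcomp gA (N i j) (- x - nu i + nu j).
have XN0 : X *m N0 = 1%:M.
  apply/matrixP => i k; rewrite !mxE.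
  transitivity (hcomp gA (\sum_j X i j * N j k) (- nu i + nu k)).
    rewrite hcomp_big; apply: eq_bigr => j _; rewrite mxE -(hcomp_mull _ _ (hX i j)).
    by rewrite deg_mul subrr sub0r.
  have -> : \sum_j X i j * N j k = (X *m N) i k by rewrite mxE.
  rewrite XN mxE; case: eqP => [->|_]; last by rewrite hcomp0.
  by rewrite addNr (hcomp_homog _ (gr1 gA)) eqxx.
have -> : N = N0 by rewrite -[N0]mul1mx -NX -mulmxA XN0 mulmx1.
by move=> i j; rewrite mxE; apply: hcomp_gr.
Qed.

End GradedInverse.

(** * The map J_s on rectangular matrices *)

Section Jmx.
Variables (K : fieldType) (G : zmodType) (A : algType K) (gA : grading G A).
Variable s : bicharacter K G.
Local Notation B := (twisted gA s).

Definition Jmx2 m n (nu : 'I_m -> G) (mu : 'I_n -> G) (x : G) (X : 'M[A]_(m, n)) : 'M[B]_(m, n) :=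
  \matrix_(i, j) ((s x (mu j) * (s (nu i) (x - nu i + mu j))^-1) *: (X i j : B)).

(** The coefficients of the two entries, times the factor s(x - nu_i + mu_j, z - mu_j + rho_k) of
    the twisted product, no longer involve mu_j: what remains is s(x, z) times the coefficient of
    the product. *)
Lemma Jmx2_mul m n p (nu : 'I_m -> G) (mu : 'I_n -> G) (rho : 'I_p -> G) x z X Z :
  mx_homog2 gA nu mu x X -> mx_homog2 gA mu rho z Z ->
  Jmx2 nu mu x X *m Jmx2 mu rho z Z = (s x z)%:A *: Jmx2 nu rho (x + z) (X *m Z).
Proof.
move=> hX hZ; apply/matrixP => i k; rewrite !mxE.
rewrite mulr_algl !scaler_sumr; apply: eq_bigr => j _; rewrite !mxE.
rewrite -scalerAl -scalerAr !scalerA.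
have -> : (X i j : B) * (Z j k : B) =
    s (x - nu i + mu j) (z - mu j + rho k) *: (X i j * Z j k : A) :> A.
  exact: (twistedM (hX i j) (hZ j k)).
rewrite scalerA; congr (_ *: _).
by rewrite !bicharE; field; rewrite !bichar_neq0 oner_neq0.
Qed.

Lemma Jmx2_1 n (nu : 'I_n -> G) : Jmx2 nu nu 0 1%:M = 1%:M.
Proof.
apply/matrixP => i j; rewrite !mxE; case: eqP => [->|_]; last by rewrite scaler0.
by rewrite sub0r addNr bichar0l bichar0r invr1 mulr1 scale1r.
Qed.

Lemma Jmx2B m n (nu : 'I_m -> G) (mu : 'I_n -> G) x (X Z : 'M[A]_(m, n)) :
  Jmx2 nu mu x (X - Z) = Jmx2 nu mu x X - Jmx2 nu mu x Z.
Proof. by apply/matrixP => i j; rewrite !mxE scalerBr. Qed.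

Lemma mulmx_algr m n p (k : K) (X : 'M[B]_(m, n)) (Z : 'M_(n, p)) :
  X *m (k%:A *: Z) = k%:A *: (X *m Z).
Proof.
apply/matrixP => i j; rewrite !mxE mulr_algl scaler_sumr; apply: eq_bigr => l _.
by rewrite mxE mulr_algl scalerAr.
Qed.

(** The factor s(x, x) compensates s(x, -x) = s(-x, x) = s(x, x)^-1 coming from [Jmx2_mul]. *)
Lemma Jmx2_inv n (nu : 'I_n -> G) x X N : mx_homog gA nu x X ->
  X *m N = 1%:M -> N *m X = 1%:M ->
  let N' := (s x x)%:A *: Jmx2 nu nu (- x) N in
  Jmx2 nu nu x X *m N' = 1%:M /\ N' *m Jmx2 nu nu x X = 1%:M.
Proof.
move=> hX XN NX; have hN := mx_homog_inv hX XN NX.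
have e : s x x * (s x x)^-1 = 1 by rewrite divff // bichar_neq0.
rewrite /= mulmx_algr -scalemxAl !Jmx2_mul // XN NX subrr addNr Jmx2_1.
by rewrite bicharNr bicharNl scalerA -scalerAl mul1r scalerA e !scale1r.
Qed.

End Jmx.

(** * Blocks of an inverse matrix *)

Section BlockInverse.
Variables (R : pzRingType) (r0 r1 : nat).
Implicit Types X N : 'M[R]_(r0 + r1).

Lemma mul_submx_eq1 X N : X *m N = 1%:M ->
  [/\ ulsubmx X *m ulsubmx N + ursubmx X *m dlsubmx N = 1%:M,
      ulsubmx X *m ursubmx N + ursubmx X *m drsubmx N = 0,
      dlsubmx X *m ulsubmx N + drsubmx X *m dlsubmx N = 0
    & dlsubmx X *m ursubmx N + drsubmx X *m drsubmx N = 1%:M].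
Proof.
rewrite -{1}[X]submxK -{1}[N]submxK mulmx_block scalar_mx_block.
by case/eq_block_mx.
Qed.

Lemma schur_inv X N D : X *m N = 1%:M -> N *m X = 1%:M ->
  drsubmx X *m D = 1%:M -> D *m drsubmx X = 1%:M ->
  schur X *m ulsubmx N = 1%:M /\ ulsubmx N *m schur X = 1%:M.
Proof.
move=> /mul_submx_eq1[e00 _ e10 _] /mul_submx_eq1[f00 f01 _ _] eD De.
rewrite /schur (@rinvE _ (drsubmx X : 'M_r1) D eD De); split.
  rewrite mulmxBl -!mulmxA (_ : dlsubmx X *m _ = - (drsubmx X *m dlsubmx N)).
    by rewrite !mulmxN (mulmxA D) De mul1mx opprK.
  by apply/eqP; rewrite -addr_eq0 e10.
rewrite mulmxBr !mulmxA (_ : ulsubmx N *m ursubmx X = - (ursubmx N *m drsubmx X)).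
  by rewrite !mulNmx -(mulmxA _ _ D) eD mulmx1 opprK.
by apply/eqP; rewrite -addr_eq0 f01.
Qed.

End BlockInverse.

(** * Parity *)

Section Parity.
Variables (K : fieldType) (charK : [pchar K] =i pred0).
Variables (G : zmodType) (lam : bicharacter K G) (hlam : commutation_factor lam).

Lemma two_neq0 : 2%:R != 0 :> K.
Proof. by move/pcharf0P: charK => ->. Qed.

Lemma N1_neq1 : (-1 == 1 :> K) = false.
Proof. by rewrite eq_sym -subr_eq0 opprK (negbTE two_neq0). Qed.

Lemma comfactor_diag x : lam x x = (-1) ^+ odd_deg lam x.
Proof.
have /eqP := hlam x x; rewrite -expr2 sqrf_eq1 /odd_deg => /orP[]/eqP ->.
  by rewrite eq_sym N1_neq1 expr0.
by rewrite eqxx expr1.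
Qed.

Lemma even_degE x : even_deg lam x = ~~ odd_deg lam x.
Proof.
rewrite /even_deg comfactor_diag; case: odd_deg; rewrite ?expr1 ?expr0 ?eqxx //.
exact: N1_neq1.
Qed.

(** The cross terms lam(x, y) lam(y, x) cancel, so x -> lam(x, x) is a character with values 1 and
    -1. *)
Lemma odd_degD x y : odd_deg lam (x + y) = odd_deg lam x (+) odd_deg lam y.
Proof.
have e : lam (x + y) (x + y) = lam x x * lam y y.
  rewrite -[RHS]mul1r -{1}(hlam x y) bicharDl !bicharDr; ring.
rewrite {1}/odd_deg e !comfactor_diag -signr_addb.
by case: (_ (+) _); rewrite ?expr1 ?expr0 ?eqxx // eq_sym N1_neq1.
Qed.

Lemma odd_degN x : odd_deg lam (- x) = odd_deg lam x.
Proof. by rewrite /odd_deg bicharNl bicharNr invrK. Qed.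

Lemma odd_deg0 : odd_deg lam 0 = false.
Proof. by rewrite /odd_deg bichar0l eq_sym N1_neq1. Qed.

Definition odd_degE := (odd_degD, odd_degN, odd_deg0).

Variables (A : algType K) (gA : grading G A) (hA : graded_commutative lam gA).

Lemma odd_sqr_eq0 g a : odd_deg lam g -> gA g a -> a * a = 0.
Proof.
move=> og ha; have := hA ha ha; rewrite comfactor_diag og expr1 scaleN1r.
move/eqP; rewrite -subr_eq0 opprK -mulr2n -scaler_nat scaler_eq0.
by rewrite (negbTE two_neq0) => /eqP.
Qed.

(** Moving a past a homogeneous b costs only a scalar, and a a = 0. *)
Lemma odd_sandwich g a b : odd_deg lam g -> gA g a -> a * b * a = 0.
Proof.
move=> og ha; elim/(@hcomp_ind _ _ _ gA): b => [|b b' eb eb'|h b hb].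
- by rewrite mulr0 mul0r.
- by rewrite mulrDr mulrDl eb eb' addr0.
- by rewrite -mulrA (hA hb ha) -scalerAr mulrA (odd_sqr_eq0 og ha) mul0r scaler0.
Qed.

Variables (s : bicharacter K G) (hs : NS_multiplier lam s).
Local Notation B := (twisted gA s).

(** The defining equation of an NS-multiplier says that exchanging the factors of a twisted product
    costs exactly this sign. *)
Lemma twisted_supercomm g h (a b : B) : gA g (untwist a) -> gA h (untwist b) ->
  a * b = (-1) ^+ (odd_deg lam g && odd_deg lam h) * (b * a).
Proof.
move=> ha hb; rewrite mulr_sign -scaler_sign -(hs g h).
change (untwist (a * b) =
  (lam g h * s g h * (s h g)^-1) *: (untwist (b * a) : A)).
rewrite (twistedM ha hb) (twistedM hb ha) (hA ha hb) !scalerA; congr (_ *: _).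
by field; rewrite bichar_neq0.
Qed.

Lemma twisted_central g (a : B) : ~~ odd_deg lam g -> gA g (untwist a) -> central a.
Proof.
move=> og ha b; elim/(@hcomp_ind _ _ _ gA): b => [|b b' eb eb'|h b hb].
- by rewrite mulr0 mul0r.
- by rewrite [LHS]mulrDr [RHS]mulrDl eb eb'.
- by rewrite (twisted_supercomm ha (hb : gA h (untwist (b : B)))) (negbTE og) mul1r.
Qed.

Definition odd_homog (a : B) : Prop := exists g, odd_deg lam g /\ gA g (untwist a).

Lemma twisted_odd_module : odd_module (odd_span odd_homog).
Proof.
apply: odd_span_module => [a b|a|a b].
- move=> [g [og ha]] [h [oh hb]].
  by rewrite (twisted_supercomm ha hb) og oh expr1 mulN1r.
- move=> [g [og ha]]; have := twistedM ha ha.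
  by rewrite (odd_sqr_eq0 og ha) scaler0.
- move=> [g [og ha]] [h [oh hb]].
  apply: (@twisted_central (g + h)); first by rewrite odd_degD og oh.
  exact: star_gr.
Qed.

End Parity.

(** * Determinants over the twisted algebra *)

Section TwistedDet.
Variables (K : fieldType) (G : zmodType) (A : algType K) (gA : grading G A).
Variable s : bicharacter K G.
Local Notation B := (twisted gA s).

(** With products bracketed to the right, each factor contributes s of its degree and the sum of the
    later degrees, as in [pairfac]. *)
Lemma twisted_prodE I (r : seq I) (d : I -> G) (F : I -> B) :
  (forall i, gA (d i) (untwist (F i))) ->
  gA (\sum_(i <- r) d i) (untwist (\prod_(i <- r) F i)) /\
  untwist (\prod_(i <- r) F i) =
    pairfac s [seq d i | i <- r] *: \prod_(i <- r) untwist (F i).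
Proof.
move=> hF; elim: r => [|i r [IH1 IH2]].
  by rewrite !big_nil scale1r; split=> //; apply: gr1.
rewrite !big_cons; split; first exact: (star_gr s (hF i) IH1).
by rewrite (twistedM (hF i) IH1) IH2 -scalerAr scalerA /= big_map.
Qed.

Lemma sum_deg_perm n (nu : 'I_n -> G) x (p : 'S_n) :
  \sum_i (x - nu i + nu (p i)) = x *+ n.
Proof.
rewrite big_split sumrB /= sumr_const card_ord.
by rewrite [X in _ - _ + X](_ : _ = \sum_i nu i) ?subrK // [RHS](reindex_inj (@perm_inj _ p)).
Qed.

Lemma twisted_det_gr n (nu : 'I_n -> G) x (M : 'M[B]_n) :
  (forall i j, gA (x - nu i + nu j) (untwist (M i j))) ->
  gA (x *+ n) (untwist (\det M)).
Proof.
move=> hM; apply: (@gr_sum _ _ _ gA (x *+ n)) => p.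
have [] := twisted_prodE (index_enum 'I_n) (fun i => hM i (p i)).
rewrite sum_deg_perm => hp _; rewrite /untwist in hp *.
by rewrite mulr_sign; case: odd_perm => //; apply: grN.
Qed.

End TwistedDet.

Lemma GDet_indep (K : fieldType) (G : zmodType) (A : algType K) (gA : grading G A)
    (s t : bicharacter K G) n (nu : 'I_n -> G) (Y : 'M[A]_n) :
  (forall x y, s x y / s y x = t x y / t y x) -> mx_homog gA nu 0 Y ->
  GDet gA s nu 0 Y = GDet gA t nu 0 Y.
Proof.
move=> st hY; set q := bichar_ratio s t.
have qC x y : q x y = q y x.
  apply/eqP; rewrite /= eqr_div ?bichar_neq0 // mulrC (mulrC (s y x)).
  have /eqP := st x y; rewrite eqr_div ?bichar_neq0 // => /eqP e.
  by rewrite [X in X == _]mulrC e.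
rewrite /GDet /determinant.
apply: eq_bigr => p _; rewrite ![in LHS]mulr_sign ![in RHS]mulr_sign.
suff: untwist (\prod_i Jmx gA s nu 0 Y i (p i)) =
      untwist (\prod_i Jmx gA t nu 0 Y i (p i)) :> A.
  by rewrite /untwist; case: odd_perm => [->|].
have hJ (u : bicharacter K G) i :
    gA (0 - nu i + nu (p i)) (untwist (Jmx gA u nu 0 Y i (p i))).
  by rewrite mxE; apply/grZ/hY.
rewrite (twisted_prodE _ (hJ s)).2 (twisted_prodE _ (hJ t)).2.
have eJ (u : bicharacter K G) : \prod_i untwist (Jmx gA u nu 0 Y i (p i)) =
   (\prod_i (u (nu i) (nu (p i) - nu i))^-1) *: \prod_i Y i (p i).
  rewrite -scaler_prod; apply: eq_bigr => i _.
  by rewrite mxE bichar0l mul1r sub0r addrC.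
rewrite !eJ !scalerA; congr (_ *: _).
have el : [seq 0 - nu i + nu (p i) | i <- index_enum 'I_n] =
          [seq nu (p i) - nu i | i <- index_enum 'I_n].
  by apply: eq_map => i; rewrite sub0r addrC.
(* For the symmetric ratio q, this equates the quotient of the reordering factors of s and t with
   the quotient of the products of s(nu_i, g_i) and t(nu_i, g_i), whose inverses are the
   coefficients of J. *)
have := pairfac_permB nu p qC; rewrite pairfac_ratio -el /= big_split /= !prodfV.
have nz (u : bicharacter K G) : \prod_i u (nu i) (nu (p i) - nu i) != 0.
  by apply/prodf_neq0 => i _; apply: bichar_neq0.
move/eqP; rewrite eqr_div ?pairfac_neq0 // => /eqP e.
by apply/eqP; rewrite eqr_div // e mulrC.
Qed.

(** * The graded Berezinian *)

Section GradedBerezinian.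
Variables (K : fieldType) (charK : [pchar K] =i pred0).
Variables (G : zmodType) (lam : bicharacter K G) (hlam : commutation_factor lam).
Variables (A : algType K) (gA : grading G A) (hA : graded_commutative lam gA).

Section Det.
Variables (s : bicharacter K G) (hs : NS_multiplier lam s).
Variables (n : nat) (nu : 'I_n -> G) (x : G) (b : bool) (Y : 'M[A]_n).
Hypotheses (nub : forall i, odd_deg lam (nu i) = b) (evx : ~~ odd_deg lam x).
Hypothesis hY : mx_homog gA nu x Y.

Lemma central_Jmx : central_mx (Jmx gA s nu x Y).
Proof.
move=> i j; apply: (twisted_central hA hs (g := x - nu i + nu j)).
  by rewrite !(odd_degE charK hlam) !nub (negbTE evx) addbK.
by rewrite mxE; apply/grZ/hY.
Qed.

Lemma GDet_gr : gA (x *+ n) (GDet gA s nu x Y).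
Proof. by apply: (twisted_det_gr (nu := nu)) => i j; rewrite mxE; apply/grZ/hY. Qed.

(** Here d inverts the determinant in the twisted algebra. The degrees are nx and -nx, and s(nx,
    -nx) = s(x, x)^(-n^2), so in A the product is s(x, x)^(n^2). *)
Lemma GDet_inv : invertible Y -> exists d : A,
  [/\ gA (- x *+ n) d,
      (\det (Jmx gA s nu x Y) : twisted gA s) * (d : twisted gA s) = 1,
      (d : twisted gA s) * (\det (Jmx gA s nu x Y) : twisted gA s) = 1,
      GDet gA s nu x Y * d = (s x x ^+ (n * n)) *: 1
    & d * GDet gA s nu x Y = (s x x ^+ (n * n)) *: 1].
Proof.
move=> /invertible_mxP[N [YN NY]]; have hN := mx_homog_inv hY YN NY.
have [] := Jmx2_inv s hY YN NY; set N' := _ *: _ => JN NJ.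
have cJ := central_Jmx; have cN' := central_mx_inv JN NJ cJ.
have hd : gA (- x *+ n) (untwist (\det N')).
  apply: (twisted_det_gr (nu := nu)) => i j.
  by rewrite /N' !mxE mulr_algl; do 2!apply: grZ; apply: hN.
have e1 : \det (Jmx gA s nu x Y) * \det N' = 1 by rewrite -central_detM // JN det_id.
have e2 : \det N' * \det (Jmx gA s nu x Y) = 1 by rewrite -central_detM // NJ det_id.
have sc : s (x *+ n) (- x *+ n) = (s x x ^+ (n * n))^-1.
  by rewrite bicharMnl bicharMnr bicharNr -exprVn -exprM mulnn exprVn.
have sc' : s (- x *+ n) (x *+ n) = (s x x ^+ (n * n))^-1.
  by rewrite bicharMnl bicharMnr bicharNl -exprVn -exprM mulnn exprVn.
have nz : s x x ^+ (n * n) != 0 by rewrite expf_neq0 // bichar_neq0.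
exists (untwist (\det N')); split=> //.
- have := twistedM GDet_gr hd; rewrite sc => e.
  have {}e : 1 = (s x x ^+ (n * n))^-1 *: (GDet gA s nu x Y * untwist (\det N')) :> A.
    by rewrite -e -[LHS]/(untwist (1 : twisted gA s)) -e1.
  by rewrite e scalerA divff // scale1r.
- have := twistedM hd GDet_gr; rewrite sc' => e.
  have {}e : 1 = (s x x ^+ (n * n))^-1 *: (untwist (\det N') * GDet gA s nu x Y) :> A.
    by rewrite -e -[LHS]/(untwist (1 : twisted gA s)) -e2.
  by rewrite e scalerA divff // scale1r.
Qed.

Lemma GDet_invertible : invertible Y -> invertible (GDet gA s nu x Y).
Proof.
move=> /GDet_inv[d [_ _ _ e1 e2]]; have nz : s x x ^+ (n * n) != 0.
  by rewrite expf_neq0 // bichar_neq0.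
exists ((s x x ^+ (n * n))^-1 *: d).
by rewrite -scalerAr -scalerAl e1 e2 scalerA mulVf // scale1r.
Qed.

End Det.

Variables (r0 r1 : nat) (nu0 : 'I_r0 -> G) (nu1 : 'I_r1 -> G).
Hypotheses (hnu0 : forall i, even_deg lam (nu0 i)) (hnu1 : forall i, odd_deg lam (nu1 i)).
Local Notation nu := (join_deg nu0 nu1).

Lemma even_nu0 i : odd_deg lam (nu0 i) = false.
Proof. by apply/negbTE; rewrite -(even_degE charK hlam). Qed.

Lemma join_degl i : nu (lshift r1 i) = nu0 i.
Proof. by rewrite /join_deg (unsplitK (inl i)). Qed.

Lemma join_degr i : nu (rshift r0 i) = nu1 i.
Proof. by rewrite /join_deg (unsplitK (inr i)). Qed.

Lemma mx_homog_blocks x (X : 'M[A]_(r0 + r1)) : mx_homog gA nu x X ->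
  [/\ mx_homog gA nu0 x (ulsubmx X), mx_homog2 gA nu0 nu1 x (ursubmx X),
      mx_homog2 gA nu1 nu0 x (dlsubmx X) & mx_homog gA nu1 x (drsubmx X)].
Proof.
move=> hX; split=> i j; rewrite !mxE.
- by have := hX (lshift r1 i) (lshift r1 j); rewrite !join_degl.
- by have := hX (lshift r1 i) (rshift r0 j); rewrite join_degl join_degr.
- by have := hX (rshift r0 i) (lshift r1 j); rewrite join_degl join_degr.
- by have := hX (rshift r0 i) (rshift r0 j); rewrite !join_degr.
Qed.

Lemma Jmx_blocks s x (X : 'M[A]_(r0 + r1)) :
  [/\ ulsubmx (Jmx gA s nu x X) = Jmx gA s nu0 x (ulsubmx X),
      ursubmx (Jmx gA s nu x X) = Jmx2 gA s nu0 nu1 x (ursubmx X),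
      dlsubmx (Jmx gA s nu x X) = Jmx2 gA s nu1 nu0 x (dlsubmx X)
    & drsubmx (Jmx gA s nu x X) = Jmx gA s nu1 x (drsubmx X)].
Proof. by split; apply/matrixP => i j; rewrite !mxE ?join_degl ?join_degr. Qed.

Section Homogeneous.
Variables (x : G) (X : 'M[A]_(r0 + r1)).
Hypotheses (evx : ~~ odd_deg lam x) (GX : GLhom gA nu x X).

Lemma GLhom_drsub : invertible (drsubmx X).
Proof.
case: GX => hX /invertible_mxP[N [XN NX]]; have hN := mx_homog_inv hX XN NX.
have [_ _ hX10 _] := mx_homog_blocks hX; have [_ _ hN10 _] := mx_homog_blocks hN.
have odd10 z (P : 'M[A]_(r1, r0)) Q : ~~ odd_deg lam z -> mx_homog2 gA nu1 nu0 z P ->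
    invertible (1%:M - P *m Q).
  move=> evz hP; apply: invertible_subr_sandwich => i j a.
  apply: (odd_sandwich charK hlam hA (g := z - nu1 i + nu0 j)) (hP i j).
  by rewrite !(odd_degE charK hlam) hnu1 even_nu0 (negbTE evz).
have [_ _ _ e1] := mul_submx_eq1 XN; have [_ _ _ e2] := mul_submx_eq1 NX.
(* The block N_11 of the inverse serves on both sides: X_11 N_11 = 1 - X_10 N_01 and N_11 X_11 = 1 -
   N_10 X_01. *)
apply: (@invertible_factor _ (drsubmx X : 'M_r1) (drsubmx N) (drsubmx N)).
  rewrite [X in invertible X](_ : _ = 1%:M - dlsubmx X *m ursubmx N); first exact: odd10 hX10.
  by rewrite -e1 [X in X - _]addrC addrK.
rewrite [X in invertible X](_ : _ = 1%:M - dlsubmx N *m ursubmx X).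
  by apply: odd10 hN10; rewrite (odd_degN).
by rewrite -e2 [X in X - _]addrC addrK.
Qed.

Lemma GLhom_schur : GLhom gA nu0 x (schur X).
Proof.
case: GX => hX /invertible_mxP[N [XN NX]].
have [hX00 hX01 hX10 hX11] := mx_homog_blocks hX.
have /invertible_mxP[D [eD De]] := GLhom_drsub; have hD := mx_homog_inv hX11 eD De.
split; last by have [] := schur_inv XN NX eD De; exists (ulsubmx N).
rewrite /schur (@rinvE _ (drsubmx X : 'M_r1) D eD De) => i j; rewrite [_ i j]mxE.
apply: grD; first exact: hX00.
rewrite mxE; apply: grN; have := mx_homog2_mul (mx_homog2_mul hX01 hD) hX10.
by rewrite subrr add0r; apply.
Qed.

(** In the triple product, s(x, -x) from the first multiplication cancels the factor s(x, x) of the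
    inverse of J_s(X_11), and the second contributes s(0, x) = 1. *)
Lemma schur_Jmx s : schur (Jmx gA s nu x X) = Jmx gA s nu0 x (schur X).
Proof.
case: GX => hX _; have [hX00 hX01 hX10 hX11] := mx_homog_blocks hX.
have /invertible_mxP[D [eD De]] := GLhom_drsub; have hD := mx_homog_inv hX11 eD De.
have [J1 J2] := Jmx2_inv s hX11 eD De.
rewrite /schur; have [-> -> -> ->] := Jmx_blocks s x X.
rewrite (@rinvE _ (drsubmx X : 'M_r1) D eD De).
rewrite (@rinvE _ (Jmx gA s nu1 x (drsubmx X) : 'M_r1) _ J1 J2).
rewrite mulmx_algr -scalemxAl Jmx2_mul //.
rewrite -scalemxAl Jmx2_mul //; last exact: mx_homog2_mul hX01 hD.
rewrite subrr add0r bichar0l bicharNr.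
rewrite [X in _ - X](_ : _ = Jmx2 gA s nu0 nu0 x (ursubmx X *m D *m dlsubmx X)).
  by rewrite -Jmx2B.
by rewrite !scalerA scale1r mulr1 mulr_algl scalerA divff ?bichar_neq0 // !scale1r.
Qed.

Lemma Jmx_invertible s : invertible (Jmx gA s nu x X).
Proof.
case: GX => hX /invertible_mxP[N [XN NX]].
by exists ((s x x)%:A *: Jmx2 gA s nu nu (- x) N); apply: Jmx2_inv.
Qed.

Lemma drsub_Jmx_invertible s : invertible (drsubmx (Jmx gA s nu x X)).
Proof.
have [hX _] := GX; have [_ _ _ hX11] := mx_homog_blocks hX.
have /invertible_mxP[D [eD De]] := GLhom_drsub; have [_ _ _ ->] := Jmx_blocks s x X.
by exists ((s x x)%:A *: Jmx2 gA s nu1 nu1 (- x) D); apply: Jmx2_inv.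
Qed.

Section Multiplier.
Variables (s : bicharacter K G) (hs : NS_multiplier lam s).

Lemma super_Jmx : super_mx (odd_span (odd_homog lam (s := s) (gA := gA))) (Jmx gA s nu x X).
Proof.
case: GX => hX _; have [hX00 hX01 hX10 hX11] := mx_homog_blocks hX.
rewrite /super_mx; have [-> -> -> ->] := Jmx_blocks s x X; split.
- exact: (central_Jmx hs even_nu0).
- move=> i j; apply: odd_span_gen; exists (x - nu0 i + nu1 j); split.
    by rewrite !(odd_degE charK hlam) hnu1 even_nu0 (negbTE evx).
  by rewrite mxE; apply/grZ/hX01.
- move=> i j; apply: odd_span_gen; exists (x - nu1 i + nu0 j); split.
    by rewrite !(odd_degE charK hlam) hnu1 even_nu0 (negbTE evx).
  by rewrite mxE; apply/grZ/hX10.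
- exact: (central_Jmx hs hnu1).
Qed.

Lemma even_super_Jmx : even_supermx lam (Jmx gA s nu x X).
Proof.
case: GX => hX _; have [hX00 hX01 hX10 hX11] := mx_homog_blocks hX.
have hp p g a : gA g a -> odd_deg lam g = p -> super_part gA lam p a.
  move=> ha gp h; rewrite (hcomp_homog _ ha); have [->//|_] := eqVneq h g.
  by rewrite eqxx.
rewrite /even_supermx; have [-> -> -> ->] := Jmx_blocks s x X.
split=> i j; rewrite mxE /untwist.
- apply: hp (grZ _ (hX00 i j)) _.
  by rewrite !(odd_degE charK hlam) !even_nu0 (negbTE evx).
- apply: hp (grZ _ (hX01 i j)) _.
  by rewrite !(odd_degE charK hlam) hnu1 even_nu0 (negbTE evx).
- apply: hp (grZ _ (hX10 i j)) _.
  by rewrite !(odd_degE charK hlam) hnu1 even_nu0 (negbTE evx).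
- apply: hp (grZ _ (hX11 i j)) _.
  by rewrite !(odd_degE charK hlam) !hnu1 (negbTE evx).
Qed.

Lemma GBerE : GBer gA s nu0 nu1 x X =
  s x x ^ (- (r1%:Z * (r0%:Z - r1%:Z))) *:
    (GDet gA s nu0 x (schur X) * rinv (GDet gA s nu1 x (drsubmx X))).
Proof.
case: GX => hX _; have [_ _ _ hX11] := mx_homog_blocks hX.
have [hS _] := GLhom_schur.
have [d [hd e1 e2 f1 f2]] := GDet_inv hs hnu1 evx hX11 GLhom_drsub.
have nz : s x x ^+ (r1 * r1) != 0 by rewrite expf_neq0 // bichar_neq0.
have -> : rinv (GDet gA s nu1 x (drsubmx X)) = (s x x ^+ (r1 * r1))^-1 *: d.
  by apply: rinvE; rewrite -?scalerAr -?scalerAl ?f1 ?f2 scalerA mulVf // scale1r.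
rewrite /GBer /Ber schur_Jmx; have [_ _ _ ->] := Jmx_blocks s x X.
rewrite (@rinvE _ (\det (Jmx gA s nu1 x (drsubmx X))) d e1 e2).
rewrite (twistedM (GDet_gr s hS) hd) -scalerAr scalerA; congr (_ *: _).
(* The twisted product of degrees r0 x and -r1 x gives the exponent -r0 r1, and passing from d to
   the inverse in A gives r1^2. *)
rewrite bicharMnl bicharMnr bicharNr -exprM !exprVn !exprnN -expfzDr ?bichar_neq0 //.
by congr (_ ^ _); rewrite !PoszM; ring.
Qed.

Lemma GBer_gr : gA (x *+ r0 + - x *+ r1) (GBer gA s nu0 nu1 x X).
Proof.
case: GX => hX _; have [_ _ _ hX11] := mx_homog_blocks hX.
have [hS _] := GLhom_schur.
have [d [hd e1 e2 _ _]] := GDet_inv hs hnu1 evx hX11 GLhom_drsub.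
rewrite /GBer /Ber schur_Jmx; have [_ _ _ ->] := Jmx_blocks s x X.
rewrite (@rinvE _ (\det (Jmx gA s nu1 x (drsubmx X))) d e1 e2).
exact: (star_gr s (GDet_gr s hS) hd).
Qed.

Lemma GBer_invertible : invertible (GBer gA s nu0 nu1 x X).
Proof.
case: GX => hX _; have [_ _ _ hX11] := mx_homog_blocks hX.
have [hS iS] := GLhom_schur.
have [d Dd] := GDet_invertible hs hnu1 evx hX11 GLhom_drsub.
have [u v] := rinvP (ex_intro _ d Dd).
rewrite GBerE; set c := _ ^ _.
have nc : c != 0 by rewrite expfz_neq0 // bichar_neq0.
have iab : invertible (GDet gA s nu0 x (schur X) * rinv (GDet gA s nu1 x (drsubmx X))).
  apply: invertibleM; first exact: (GDet_invertible hs even_nu0).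
  by exists (GDet gA s nu1 x (drsubmx X)).
case: iab => e [e1 e2]; exists (c^-1 *: e).
by rewrite -!scalerAr -!scalerAl e1 e2 !scalerA mulVf ?mulfV // scale1r.
Qed.

End Multiplier.
End Homogeneous.

Lemma GBer_mul s X Z : NS_multiplier lam s -> GLhom gA nu 0 X -> GLhom gA nu 0 Z ->
  GBer gA s nu0 nu1 0 (X *m Z) = GBer gA s nu0 nu1 0 X * GBer gA s nu0 nu1 0 Z.
Proof.
move=> hs GX GZ; have ev0 : ~~ odd_deg lam 0 by rewrite (odd_deg0 charK).
have JM : Jmx gA s nu 0 (X *m Z) = Jmx gA s nu 0 X *m Jmx gA s nu 0 Z.
  have := Jmx2_mul s GX.1 GZ.1.
  by rewrite bichar0l addr0 !scale1r => ->.
rewrite {1}/GBer JM (Ber_mul (twisted_odd_module charK hlam hA hs)).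
(* Both Berezinians have degree 0, where the twisted product is that of A. *)
- have hX := GBer_gr ev0 GX hs; have hZ := GBer_gr ev0 GZ hs.
  rewrite mul0rn oppr0 mul0rn addr0 in hX hZ.
  by rewrite (twistedM hX hZ) bichar0l scale1r.
- exact: super_Jmx.
- exact: super_Jmx.
- exact: drsub_Jmx_invertible.
- exact: drsub_Jmx_invertible.
Qed.

End GradedBerezinian.

Theorem theorem5 (K : fieldType) (charK : [pchar K] =i pred0)
    (G : zmodType) (fgG : finitely_generated G)
    (lam : bicharacter K G) (hlam : commutation_factor lam)
    (A : algType K) (gA : grading G A) (hA : graded_commutative lam gA)
    (r0 r1 : nat) (nu0 : 'I_r0 -> G) (nu1 : 'I_r1 -> G)
    (hnu0 : forall i, even_deg lam (nu0 i))
    (hnu1 : forall i, odd_deg lam (nu1 i)) :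
  ((forall s s' : bicharacter K G,
      NS_multiplier lam s -> NS_multiplier lam s' ->
      forall X : 'M[A]_(r0 + r1), GLhom gA (join_deg nu0 nu1) 0 X ->
      GBer gA s nu0 nu1 0 X = GBer gA s' nu0 nu1 0 X) /\
   (forall s : bicharacter K G, NS_multiplier lam s ->
      group_morphism (GLhom gA (join_deg nu0 nu1) 0) (@invertible A)
        (GBer gA s nu0 nu1 0)))
  /\
  (forall (x : G) (s : bicharacter K G) (X : 'M[A]_(r0 + r1)),
     even_deg lam x -> NS_multiplier lam s ->
     GLhom gA (join_deg nu0 nu1) x X ->
     let Y := Jmx gA s (join_deg nu0 nu1) x X in
     [/\ (* Ber is defined at J_s(X), with values in A^* *)
         [/\ even_supermx lam Y, invertible Y, invertible (drsubmx Y),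
             invertible (\det (drsubmx Y))
           & invertible (GBer gA s nu0 nu1 x X)],
         (* the right-hand side is defined *)
         [/\ invertible (drsubmx X), mx_homog gA nu0 x (schur X),
             mx_homog gA nu1 x (drsubmx X)
           & invertible (GDet gA s nu1 x (drsubmx X))]
       & GBer gA s nu0 nu1 x X =
           s x x ^ (- (r1%:Z * (r0%:Z - r1%:Z))) *:
             (GDet gA s nu0 x (schur X) *
              rinv (GDet gA s nu1 x (drsubmx X)))]).
Proof.
have ev y : even_deg lam y -> ~~ odd_deg lam y by rewrite (even_degE charK hlam).
have ev0 : ~~ odd_deg lam 0 by rewrite (odd_deg0 charK).
have G1 : GLhom gA (join_deg nu0 nu1) 0 1%:M.
  split; last by exists 1%:M; split; apply: mulmx1.
  move=> i j; rewrite mxE; case: eqP => [->|_]; last exact: gr0.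
  by rewrite sub0r addNr; apply: gr1.
have GM X Z : GLhom gA (join_deg nu0 nu1) 0 X -> GLhom gA (join_deg nu0 nu1) 0 Z ->
    GLhom gA (join_deg nu0 nu1) 0 (X *m Z).
  move=> [hX iX] [hZ iZ]; split; last exact: (@invertibleM _ (X : 'M_(r0 + r1)) Z).
  by have := mx_homog2_mul hX hZ; rewrite addr0.
split; first split.
- move=> s s' hs hs' X GX.
  rewrite !(GBerE charK hlam hA hnu0 hnu1 ev0 GX) //.
  (* Both sides, multiplied by lam(x, y), equal the same parity sign. *)
  have ss' x y : s x y / s y x = s' x y / s' y x.
    apply: (mulfI (bichar_neq0 lam x y)); rewrite !mulrA.
    by rewrite (hs x y) (hs' x y).
  have [hS _] := GLhom_schur charK hlam hA hnu0 hnu1 ev0 GX.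
  have [_ _ _ hD] := mx_homog_blocks GX.1.
  by rewrite !bichar0l !exp1rz (GDet_indep ss' hS) (GDet_indep ss' hD).
- move=> s hs; split.
  + split=> [||X [hX /invertible_mxP[N [XN NX]]]]; [exact: G1 | exact: GM |].
    exists N; split=> //; split; last by exists X.
    by have := mx_homog_inv hX XN NX; rewrite oppr0.
  + split=> [|a b|a [b [ab ba]]]; [|exact: invertibleM|].
      by exists 1; rewrite mulr1.
    by exists b; split=> //; exists a.
  + by move=> X GX; apply: (GBer_invertible charK hlam hA hnu0 hnu1 ev0 GX hs).
  + move=> X Z GX GZ; apply: (GBer_mul charK hlam hA hnu0 hnu1 hs GX GZ).
- move=> x s X /ev evx hs GX Y.
  have iX := GLhom_drsub charK hlam hA hnu0 hnu1 evx GX.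
  have [_ _ _ hD] := mx_homog_blocks GX.1.
  have eY : drsubmx Y = Jmx gA s nu1 x (drsubmx X).
    by have [_ _ _ ->] := Jmx_blocks gA nu0 nu1 s x X.
  split; last exact: (GBerE charK hlam hA hnu0 hnu1 evx GX hs).
    split.
    + exact: (even_super_Jmx charK hlam hnu0 hnu1 evx GX).
    + exact: (Jmx_invertible GX).
    + exact: (drsub_Jmx_invertible charK hlam hA hnu0 hnu1 evx GX).
    + rewrite eY; have [d [_ e1 e2 _ _]] := GDet_inv charK hlam hA hs hnu1 evx hD iX.
      by exists d.
    + exact: (GBer_invertible charK hlam hA hnu0 hnu1 evx GX hs).
  split=> //.
  + by have [] := GLhom_schur charK hlam hA hnu0 hnu1 evx GX.
  + exact: (GDet_invertible charK hlam hA hs hnu1 evx hD iX).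
Qed.
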